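(* Let $W$ be a finitely generated Coxeter group with Coxeter generating set $S$, and let $\alpha\in\mathrm{Aut}(W)$. Suppose that $\alpha(w)$ is conjugate to $w$ in $W$ for all elements $w\in W$ that can be written as products of pairwise distinct elements of $S$. Then $\alpha$ is inner.
   Context: A Coxeter generating set of $W$ is a set $S\subseteq W$ such that $(W,S)$ is a Coxeter system. *)

(* Defs.v *)
From mathcomp Require Import all_boot.
From mathcomp Require Import boolp classical_sets.

Set Implicit Arguments.
Unset Strict Implicit.
Unset Printing Implicit Defensive.

Local Open Scope group_scope.

(* Words over an alphabet I and its formal inverses: (i, false) stands for the
   letter i and (i, true) for its inverse. *)
Definition word (I : Type) := seq (I * bool).

Definition word_val (W : groupType) (I : Type) (gen : I -> W) (u : word I) : W :=
  \prod_(x <- u) (if x.2 then (gen x.1)^-1 else gen x.1).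

Definition generates (W : groupType) (I : Type) (gen : I -> W) : Prop :=
  forall w : W, exists u : word I, word_val gen u = w.

Definition finitely_generated (W : groupType) : Prop :=
  exists (n : nat) (gen : 'I_n -> W), generates gen.

(* The quotient of words by this congruence is the group <I | R>, that is, the
   free group on I modulo the normal closure of R. *)
Inductive word_equiv (I : Type) (R : set (word I)) : word I -> word I -> Prop :=
| word_equiv_refl u : word_equiv R u u
| word_equiv_sym u v : word_equiv R u v -> word_equiv R v u
| word_equiv_trans u v w :
    word_equiv R u v -> word_equiv R v w -> word_equiv R u w
| word_equiv_cancel u v i b :
    word_equiv R (u ++ [:: (i, b); (i, ~~ b)] ++ v) (u ++ v)
| word_equiv_relator u v r : R r -> word_equiv R (u ++ r ++ v) (u ++ v).

Definition presented_by (W : groupType) (I : Type) (gen : I -> W)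
    (R : set (word I)) : Prop :=
  generates gen /\
  forall u v : word I, word_val gen u = word_val gen v <-> word_equiv R u v.

(* The value 0 encodes the entry infinity, so the second condition says that
   m(s,s) = 1 and that m(s,t) is infinity or at least 2 when s <> t. *)
Definition coxeter_matrix (I : Type) (m : I -> I -> nat) : Prop :=
  (forall s t, m s t = m t s) /\ (forall s t, m s t = 1%N <-> s = t).

(* The words (s t)^m(s,t); for m(s,t) infinite (encoded by 0) this is the empty
   word, which imposes no relation. *)
Definition coxeter_relators (I : Type) (m : I -> I -> nat) : set (word I) :=
  [set r | exists s t, r = flatten (nseq (m s t) [:: (s, false); (t, false)])].

Definition coxeter_generating_set (W : groupType) (S : set W) : Prop :=
  exists m : S -> S -> nat,
    coxeter_matrix m /\
    presented_by (fun s : S => val s) (coxeter_relators m).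

Definition conjugate (W : groupType) (x y : W) : Prop := exists g : W, x = y ^ g.

Definition inner (W : groupType) (f : W -> W) : Prop :=
  exists g : W, forall w : W, f w = w ^ g.

(* Main.v *)
From mathcomp Require Import boolp classical_sets.
From mathcomp Require Import all_boot all_order all_algebra.
From mathcomp Require Import Rstruct.
From mathcomp Require Import functions reals trigo.
From mathcomp Require Import zify ring lra.
Require Import Defs.

(** Let [G] be the matrix of entries [-2 cos (pi / m s t)] and let [W] act on
    row vectors by its geometric representation, where every root is positive
    or negative and only [1] keeps all simple roots positive
    ([nonneg_of_len], [faithful]).

    Each [alpha s] is conjugate to [s], hence is the reflection in some root
    [b s].  A product of distinct generators and its image under [alpha] have
    the same trace.  The traces of all products of distinct reflections
    determine the products of Gram entries along all cycles
    ([trace_complement], [closed_walk_eq]), and these determine the Gram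
    matrix up to a choice of signs ([sign_potential]).  So after changing the
    signs of some [b s], the linear map [F] with [e s |-> b s] preserves the
    form, intertwines the action with its twist by [alpha], and permutes the
    roots ([root_automorphism_of_conj]).  Moreover, for each set [J] of
    generators the product [c] of [J] is conjugate to [alpha c].  In a
    representation that is large enough, the image of [1 - c] is the span of
    [J], so [F] preserves this span up to an element of [W] ([ra_span]).

    It remains to find [w] such that each [b s] is the image of [e s] under
    [w], up to sign ([global_conjugator]).  On a component of the diagram,
    add the vertices one at a time and keep [F], up to sign and up to an
    element of [W], a permutation of the simple roots seen so far
    ([simple_twist_extend]).  A new simple root may go to a negative root
    while the earlier ones stay positive.  The inequalities between their
    scalar products then show, by the criterion of Vinberg ([vinberg]), that
    the earlier part is of finite type, and its longest element repairs the
    sign ([longest_element]).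

    Thus on each component [F] becomes a diagram automorphism [sigma].  As [F]
    preserves the span of all simple roots but one up to [W], the maximal
    parabolic subgroups without [s] and without [sigma s] are conjugate.  If
    the conjugating element is trivial then [sigma s = s].  Otherwise it
    negates all positive roots outside a maximal parabolic subgroup, the
    component is of finite type ([posdef_of_moved]) and [sigma s] is the
    opposite of [s], where opposition is minus the longest element
    ([sigma_id_or_opp]).  Both cases cannot occur in a nontrivial way on one
    component, since the diagram would contain a cycle of length four or an
    extended diagram of type D ([id_or_opp]).  Hence [sigma] is the identity
    or the opposition, and both are induced by elements of [W].  Finally the
    elements found for the components multiply to one for [W]. *)

Set Implicit Arguments.
Unset Strict Implicit.
Unset Printing Implicit Defensive.

Import Order.TTheory GRing.Theory Num.Theory.
Local Open Scope ring_scope.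

(** * Vectors with coordinates in the simple roots, and bilinear forms *)

Section Vectors.
Variables (R : realFieldType) (n : nat).
Implicit Types (u v : 'rV[R]_n) (G A : 'M[R]_n) (J K : {set 'I_n}).

Definition simple (i : 'I_n) : 'rV[R]_n := delta_mx 0 i.

Definition nonneg v := forall i, 0 <= v 0 i.

Definition in_span J v := forall i, i \notin J -> v 0 i = 0.

Definition form G u v : R := (u *m G *m v^T) 0 0.

Lemma simpleE i j : simple i 0 j = (i == j)%:R.
Proof. by rewrite mxE eqxx eq_sym. Qed.

Lemma simple_sum v : v = \sum_i v 0 i *: simple i.
Proof. exact: row_sum_delta. Qed.

Lemma in_span_sum J v : in_span J v -> v = \sum_(i in J) v 0 i *: simple i.
Proof.
move=> vJ; rewrite {1}[v]simple_sum [LHS](bigID (mem J)) /=.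
by rewrite [X in _ + X]big1 ?addr0 // => i /vJ ->; rewrite scale0r.
Qed.

Lemma mul_simple_sum J v A :
  in_span J v -> v *m A = \sum_(i in J) v 0 i *: (simple i *m A).
Proof.
move=> vJ; rewrite {1}(in_span_sum vJ) mulmx_suml.
by apply: eq_bigr => i _; rewrite scalemxAl.
Qed.

Lemma simple_neq0 i : simple i != 0.
Proof.
by apply/eqP=> /matrixP/(_ 0 i); rewrite simpleE eqxx mxE => /eqP; rewrite oner_eq0.
Qed.

Lemma simple_inj : injective simple.
Proof.
move=> i j /matrixP/(_ 0 i); rewrite !simpleE eqxx.
by case: eqP => // _ /eqP; rewrite oner_eq0.
Qed.

Lemma in_span_simple J i : i \in J -> in_span J (simple i).
Proof. by move=> iJ j jJ; rewrite simpleE; case: eqP jJ => // <-; rewrite iJ. Qed.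

Lemma in_spanT v : in_span setT v.
Proof. by move=> i; rewrite inE. Qed.

Lemma in_span0 J : in_span J 0.
Proof. by move=> i _; rewrite mxE. Qed.

Lemma in_spanD J u v : in_span J u -> in_span J v -> in_span J (u + v).
Proof. by move=> uJ vJ i iJ; rewrite mxE uJ ?vJ ?addr0. Qed.

Lemma in_spanZ J a v : in_span J v -> in_span J (a *: v).
Proof. by move=> vJ i iJ; rewrite mxE vJ ?mulr0. Qed.

Lemma in_spanN J v : in_span J v -> in_span J (- v).
Proof. by rewrite -scaleN1r; apply: in_spanZ. Qed.

Lemma in_spanS J K v : J \subset K -> in_span J v -> in_span K v.
Proof.
by move=> sJK vJ i iK; apply: vJ; apply: contra iK; apply: (subsetP sJK).
Qed.

Lemma in_span_comb (I : finType) (P : pred I) (F : I -> 'rV_n) (c : I -> R) J :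
  (forall i, P i -> in_span J (F i)) -> in_span J (\sum_(i | P i) c i *: F i).
Proof.
move=> FJ j jJ; rewrite summxE big1 // => i Pi.
by rewrite mxE (FJ i Pi j jJ) mulr0.
Qed.

Lemma nonneg_simple i : nonneg (simple i).
Proof. by move=> j; rewrite simpleE ler0n. Qed.

Lemma nonnegD u v : nonneg u -> nonneg v -> nonneg (u + v).
Proof. by move=> u0 v0 i; rewrite mxE addr_ge0 ?u0 ?v0. Qed.

Lemma nonneg_comb (I : finType) (P : pred I) (F : I -> 'rV_n) (c : I -> R) :
  (forall i, P i -> 0 <= c i) -> (forall i, P i -> nonneg (F i)) ->
  nonneg (\sum_(i | P i) c i *: F i).
Proof.
move=> c0 F0 j; rewrite summxE sumr_ge0 // => i Pi.
by rewrite mxE mulr_ge0 ?c0 ?F0.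
Qed.

Lemma nonneg_antisym v : nonneg v -> nonneg (- v) -> v = 0.
Proof.
move=> v0 nv0; apply/rowP=> i; rewrite mxE; apply/eqP.
by rewrite eq_le v0 andbT -oppr_ge0; have := nv0 i; rewrite mxE.
Qed.

(** A simple vector spans an extremal ray of the cone of nonnegative vectors, so
    each term of a nonnegative combination equal to it is a multiple of it. *)
Lemma extremal_simple A J v t :
  in_span J v -> nonneg v -> (forall j, j \in J -> nonneg (simple j *m A)) ->
  v *m A = simple t ->
  exists2 j, j \in J & exists2 c, 0 < c & simple j *m A = c *: simple t.
Proof.
move=> vJ v0 A0 vA.
have vAi i : \sum_(j in J) v 0 j * (simple j *m A) 0 i = (t == i)%:R.
  rewrite -simpleE -vA (mul_simple_sum _ vJ) summxE.
  by apply: eq_bigr => j _; rewrite [RHS]mxE.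
have /eqP := vAi t; rewrite eqxx => /eqP sum1.
have [j /andP[jJ vj0]] : exists j, (j \in J) && (v 0 j * (simple j *m A) 0 t != 0).
  apply/existsP; apply: contraT => /existsPn all0; move: sum1; rewrite big1.
    by move=> /esym/eqP; rewrite oner_eq0.
  by move=> j jJ; have := all0 j; rewrite jJ /= negbK => /eqP.
have [vj_n0 Ajt_n0] : v 0 j != 0 /\ (simple j *m A) 0 t != 0.
  by move: vj0; rewrite mulf_eq0 negb_or => /andP.
exists j => //; exists ((simple j *m A) 0 t); first by rewrite lt_def Ajt_n0 A0.
apply/rowP => i; rewrite [RHS]mxE simpleE.
have [<-|nti] := eqVneq t i; first by rewrite mulr1.
rewrite mulr0; have := vAi i; rewrite (negbTE nti) => /eqP.
rewrite psumr_eq0; last by move=> k kJ; rewrite mulr_ge0 ?v0 ?A0.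
by move/allP/(_ j); rewrite mem_index_enum jJ mulf_eq0 (negbTE vj_n0) => /(_ isT) /eqP.
Qed.

Lemma formDl G u u' v : form G (u + u') v = form G u v + form G u' v.
Proof. by rewrite /form !mulmxDl mxE. Qed.

Lemma formZl G a u v : form G (a *: u) v = a * form G u v.
Proof. by rewrite /form -!scalemxAl mxE. Qed.

Lemma formDr G u v v' : form G u (v + v') = form G u v + form G u v'.
Proof. by rewrite /form linearD /= mulmxDr mxE. Qed.

Lemma formZr G a u v : form G u (a *: v) = a * form G u v.
Proof. by rewrite /form linearZ /= -scalemxAr mxE. Qed.

Lemma formNl G u v : form G (- u) v = - form G u v.
Proof. by rewrite -scaleN1r formZl mulN1r. Qed.

Lemma formNr G u v : form G u (- v) = - form G u v.
Proof. by rewrite -scaleN1r formZr mulN1r. Qed.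

Lemma form0l G v : form G 0 v = 0.
Proof. by rewrite -(scale0r 0) formZl mul0r. Qed.

Lemma form0r G v : form G v 0 = 0.
Proof. by rewrite -(scale0r 0) formZr mul0r. Qed.

Lemma form_suml G (I : Type) (r : seq I) (P : pred I) (F : I -> 'rV_n) v :
  form G (\sum_(i <- r | P i) F i) v = \sum_(i <- r | P i) form G (F i) v.
Proof.
by apply: (big_morph (form G ^~ v)); [move=> ? ?; apply: formDl | apply: form0l].
Qed.

Lemma form_sumr G (I : Type) (r : seq I) (P : pred I) (F : I -> 'rV_n) v :
  form G v (\sum_(i <- r | P i) F i) = \sum_(i <- r | P i) form G v (F i).
Proof.
by apply: (big_morph (form G v)); [move=> ? ?; apply: formDr | apply: form0r].
Qed.

Lemma form_simple G i j : form G (simple i) (simple j) = G i j.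
Proof. by rewrite /form -rowE trmx_delta -colE !mxE. Qed.

Lemma form_simpler G v i : form G v (simple i) = \sum_j v 0 j * G j i.
Proof. by rewrite /form trmx_delta -colE !mxE. Qed.

Lemma mul_col_form G v i : v *m col i G = (form G v (simple i))%:M.
Proof.
by rewrite [LHS]mx11_scalar /form trmx_delta -mulmxA -colE.
Qed.

Lemma form_span G J u v : in_span J u ->
  form G u v = \sum_(i in J) u 0 i * form G (simple i) v.
Proof.
move=> uJ; rewrite {1}(in_span_sum uJ) form_suml.
by apply: eq_bigr => i _; rewrite formZl.
Qed.

Lemma formC G u v : G^T = G -> form G u v = form G v u.
Proof.
move=> Gs; have -> : form G u v = (u *m G *m v^T)^T 0 0 by rewrite mxE.
by rewrite !trmx_mul trmxK Gs mulmxA.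
Qed.

End Vectors.

(** * Words, lengths and positivity of roots *)

(** For [c = 2 cos t] this is [sin (k t) / sin t].  These numbers are the
    coefficients, in the two simple roots, of the roots of a dihedral group. *)
Fixpoint chebyshev (R : realFieldType) (c : R) (k : nat) : R :=
  if k is k1.+1 then
    if k1 is k2.+1 then c * chebyshev c k1 - chebyshev c k2 else 1
  else 0.

Section Words.
Variables (W : groupType) (n : nat) (s : 'I_n -> W) (m : 'I_n -> 'I_n -> nat).
Local Open Scope nat_scope.
Local Open Scope group_scope.

Definition gen_prod (u : seq 'I_n) : W := \prod_(i <- u) s i.

Definition spans := forall w, exists u, gen_prod u = w.

Definition relations := forall i j, (s i * s j) ^+ m i j = 1.

Lemma gen_prod_nil : gen_prod [::] = 1.
Proof. exact: big_nil. Qed.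

Lemma gen_prod_cons i u : gen_prod (i :: u) = s i * gen_prod u.
Proof. exact: big_cons. Qed.

Lemma gen_prod_cat u v : gen_prod (u ++ v) = gen_prod u * gen_prod v.
Proof. exact: big_cat. Qed.

Lemma gen_prod_rcons u i : gen_prod (rcons u i) = gen_prod u * s i.
Proof. by rewrite -cats1 gen_prod_cat gen_prod_cons gen_prod_nil mulg1. Qed.

Hypotheses (s_spans : spans) (s_rel : relations) (m_diag : forall i, m i i = 1%N).

Lemma gen_sqr i : s i * s i = 1.
Proof. by have := s_rel i i; rewrite m_diag expg1. Qed.

Lemma gen_mulK i w : s i * (s i * w) = w.
Proof. by rewrite mulgA gen_sqr mul1g. Qed.

Lemma gen_inv i : (s i)^-1 = s i.
Proof. by apply: (mulgI (s i)); rewrite gen_sqr mulgV. Qed.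

Lemma gen_prod_rev u : gen_prod (rev u) = (gen_prod u)^-1.
Proof.
elim: u => [|i u IHu]; first by rewrite gen_prod_nil invg1.
by rewrite rev_cons gen_prod_rcons IHu gen_prod_cons invgM gen_inv.
Qed.

Lemma has_word w : exists k, `[< exists2 u, size u = k & gen_prod u = w >].
Proof. by have [u uw] := s_spans w; exists (size u); apply/asboolP; exists u. Qed.

Definition len w : nat := ex_minn (has_word w).

Lemma reduced_word w : exists2 u, size u = len w & gen_prod u = w.
Proof. by rewrite /len; case: ex_minnP => k /asboolP. Qed.

Lemma len_gen_prod u : len (gen_prod u) <= size u.
Proof. by rewrite /len; case: ex_minnP => k _; apply; apply/asboolP; exists u. Qed.

Lemma len_mul v w : len (v * w) <= len v + len w.
Proof.
have [u <- <-] := reduced_word v; have [u' <- <-] := reduced_word w.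
by rewrite -gen_prod_cat -size_cat len_gen_prod.
Qed.

Lemma len_gen_mul i w : len (s i * w) <= (len w).+1.
Proof.
have [u <- <-] := reduced_word w.
by rewrite -gen_prod_cons len_gen_prod.
Qed.

Lemma len_le_gen_mul i w : len w <= (len (s i * w)).+1.
Proof. by rewrite -{1}[w](gen_mulK i) len_gen_mul. Qed.

Lemma descent w : w != 1 -> exists i, len (s i * w) < len w.
Proof.
move=> w1; have [[|i u] <- uw] := reduced_word w.
  by move: w1; rewrite -uw gen_prod_nil eqxx.
by exists i; rewrite -uw gen_prod_cons gen_mulK ltnS len_gen_prod.
Qed.

Fixpoint alternating (i j : 'I_n) k :=
  if k is k'.+1 then i :: alternating j i k' else [::].

Lemma size_alternating i j k : size (alternating i j k) = k.
Proof. by elim: k i j => //= k IHk i j; rewrite IHk. Qed.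

Lemma take_alternating i j k l :
  k <= l -> take k (alternating i j l) = alternating i j k.
Proof.
elim: k l i j => [|k IHk] [|l] i j //=; rewrite ?take0 //.
by rewrite ltnS => /IHk ->.
Qed.

Lemma alternating_rcons i j k :
  alternating i j k.+1 = rcons (alternating i j k) (if odd k then j else i).
Proof.
elim: k i j => // k IHk i j.
rewrite [LHS]/= -/(alternating j i k.+1) IHk /=.
by case: (odd k).
Qed.

Lemma gen_prod_alternating_double i j k :
  gen_prod (alternating i j k.*2) = (s i * s j) ^+ k.
Proof.
elim: k => [|k IHk]; first by rewrite gen_prod_nil.
by rewrite doubleS /= !gen_prod_cons IHk expgS mulgA.
Qed.

(** The alternating word of length [m i j] can start with either letter, so that
    one more letter in front of it cancels. *)
Lemma len_gen_alternating i j k w : (0 < m i j <= k)%N ->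
  (len (s i * (gen_prod (alternating j i k) * w)) < k + len w)%N.
Proof.
case/andP=> m_gt0 mk.
have -> : gen_prod (alternating j i k) =
  gen_prod (alternating j i (m i j)) * gen_prod (drop (m i j) (alternating j i k)).
  by rewrite -gen_prod_cat -(take_alternating j i mk) cat_take_drop.
have long : (m i j < (m i j).*2)%N by rewrite -addnn -{1}[m i j]addn0 ltn_add2l.
have -> : s i * (gen_prod (alternating j i (m i j)) *
    gen_prod (drop (m i j) (alternating j i k)) * w) =
  gen_prod (rev (drop (m i j).+1 (alternating i j (m i j).*2))) *
    (gen_prod (drop (m i j) (alternating j i k)) * w).
  rewrite !mulgA -gen_prod_cons -/(alternating i j (m i j).+1); congr (_ * _ * _).
  rewrite gen_prod_rev; apply: (mulIg (gen_prod (drop (m i j).+1 (alternating i j (m i j).*2)))).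
  rewrite mulVg -gen_prod_cat -(take_alternating i j long) cat_take_drop.
  by rewrite gen_prod_alternating_double s_rel.
apply: leq_ltn_trans (len_mul _ _) _.
apply: leq_ltn_trans (leq_add (len_gen_prod _) (len_mul _ _)) _.
rewrite size_rev size_drop size_alternating addnA ltn_add2r.
apply: leq_ltn_trans (leq_add (leqnn _) (len_gen_prod _)) _.
by rewrite size_drop size_alternating; lia.
Qed.

End Words.

Section Positivity.
Variables (R : realFieldType) (W : groupType) (n : nat).
Variables (s : 'I_n -> W) (m : 'I_n -> 'I_n -> nat).
Variables (G : 'M[R]_n) (rho : W -> 'M[R]_n).

(** These properties of the Gram matrix and of the geometric representation are
    all that the theory of roots below uses.  By [rep_cheb] the roots of the
    dihedral parabolic subgroups are positive or negative; [rep_off] says that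
    two simple roots are orthogonal or meet at an angle of at least 120 degrees. *)
Record reflection_rep : Prop := ReflectionRep {
  rep_spans : spans s;
  rep_rel : relations s m;
  rep_mdiag : forall i, m i i = 1%N;
  rep_sym : G^T = G;
  rep_diag : forall i, G i i = 2;
  rep_cheb : forall i j k, i != j -> m i j = 0%N \/ (k <= m i j)%N ->
    0 <= chebyshev (- G i j) k;
  rep_off : forall i j, i != j -> G i j = 0 \/ G i j <= -1;
  rep_ge : forall i j, -2 <= G i j;
  rep1 : rho 1%g = 1%:M;
  repM : forall v w, rho (v * w)%g = rho v *m rho w;
  rep_gen : forall i, rho (s i) = 1%:M - col i G *m simple R i }.

Hypothesis rep : reflection_rep.
Local Notation e := (simple R).
Local Notation B := (form G).
Let gens := rep_spans rep.
Let rels := rep_rel rep.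
Let mdiag := rep_mdiag rep.
Local Notation length := (len gens).

Lemma rho_gen v i : v *m rho (s i) = v - B v (e i) *: e i.
Proof.
by rewrite (rep_gen rep) mulmxBr mulmx1 mulmxA mul_col_form mul_scalar_mx.
Qed.

Lemma B_sym u v : B u v = B v u.
Proof. exact: formC (rep_sym rep). Qed.

Lemma B_simple i : B (e i) (e i) = 2.
Proof. by rewrite form_simple (rep_diag rep). Qed.

Lemma rho_gen_simple i : e i *m rho (s i) = - e i.
Proof. by rewrite rho_gen B_simple scaler_nat mulr2n opprD addNKr. Qed.

Lemma alternating_act i j k : e i *m rho (gen_prod s (alternating j i k)) =
  if odd k then chebyshev (- G i j) k.+1 *: e j + chebyshev (- G i j) k *: e i
  else chebyshev (- G i j) k.+1 *: e i + chebyshev (- G i j) k *: e j.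
Proof.
elim: k => [|k IHk]; first by rewrite gen_prod_nil (rep1 rep) mulmx1 /= scale1r scale0r addr0.
rewrite alternating_rcons gen_prod_rcons (repM rep) mulmxA IHk.
have Gji : G j i = G i j by rewrite -[in LHS](rep_sym rep) mxE.
rewrite [odd k.+1]/=; case: (odd k) => /=; rewrite rho_gen formDl !formZl !form_simple.
  rewrite (rep_diag rep) Gji; apply/rowP=> l; rewrite !mxE; ring.
by rewrite (rep_diag rep); apply/rowP=> l; rewrite !mxE; ring.
Qed.

(** Split off the longest reduced prefix of [w] that alternates between [i] and
    another descent [j].  Neither letter is a descent of the remaining factor,
    so induction applies to it for both [e i] and [e j], and the prefix maps
    [e i] to a combination of these with Chebyshev coefficients. *)
Lemma nonneg_of_len w i : (length w <= length (s i * w)%g)%N -> nonneg (e i *m rho w).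
Proof.
have [N] := ubnP (length w); elim: N w i => // N IHN w i.
rewrite ltnS => w_le_N w_le_sw.
have [->|w_n1] := eqVneq w 1%g; first by rewrite (rep1 rep) mulmx1; apply: nonneg_simple.
have [j sjw] := descent gens rels mdiag w_n1.
have nij : i != j.
  by apply/eqP=> ij; move: w_le_sw sjw; rewrite ij leqNgt => /negP.
pose P k := `[< exists v, w = (gen_prod s (alternating j i k) * v)%g
                       /\ length w = (k + length v)%N >].
have exP : exists k, P k.
  exists 1%N; apply/asboolP; exists (s j * w)%g; split.
    by rewrite /= gen_prod_cons gen_prod_nil mulg1 (gen_mulK rels mdiag).
  by apply/eqP; rewrite eqn_leq (len_le_gen_mul gens rels mdiag).
have boundP k : P k -> (k <= length w)%N.
  by case/asboolP=> v [_ ->]; apply: leq_addr.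
case: (ex_maxnP exP boundP) => k /asboolP[v [wE wlen]] kmax.
have k_gt0 : (0 < k)%N.
  apply: (kmax 1%N); apply/asboolP; exists (s j * w)%g; split.
    by rewrite /= gen_prod_cons gen_prod_nil mulg1 (gen_mulK rels mdiag).
  by apply/eqP; rewrite eqn_leq (len_le_gen_mul gens rels mdiag).
have v_lt : (length v < N)%N.
  by apply: leq_trans w_le_N; rewrite wlen -{1}[length v]add0n ltn_add2r.
have vnext : (length v <= length (s (if odd k then i else j) * v)%g)%N.
  rewrite leqNgt; apply/negP=> lt_v.
  suff : P k.+1 by move/kmax; rewrite ltnn.
  apply/asboolP; exists (s (if odd k then i else j) * v)%g; split.
    by rewrite alternating_rcons gen_prod_rcons -mulgA (gen_mulK rels mdiag).
  rewrite wlen addSnnS; congr (_ + _)%N; apply/eqP.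
  by rewrite eqn_leq (len_le_gen_mul gens rels mdiag).
have vlast : (length v <= length (s (if odd k then j else i) * v)%g)%N.
  rewrite leqNgt; apply/negP=> lt_v.
  have : (length w < k + length v)%N.
    case: k k_gt0 wE {kmax wlen vnext} lt_v => // k _ wE lt_v.
    rewrite wE alternating_rcons gen_prod_rcons -mulgA addSnnS.
    apply: leq_ltn_trans (len_mul _ _ _) _.
    apply: leq_ltn_trans (leq_add (len_gen_prod _ _) (leqnn _)) _.
    rewrite size_alternating ltn_add2l ltnS.
    by move: lt_v => /=; case: (odd k) => /= /ltnW.
  by rewrite wlen ltnn.
have [vi vj] : nonneg (e i *m rho v) /\ nonneg (e j *m rho v).
  by move: vnext vlast; case: (odd k) => ? ?; split; apply: IHN.
(* A longer prefix could be rewritten to start with [i], against the length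
   hypothesis on [s i * w]. *)
have k_lt : m i j = 0%N \/ (k.+1 <= m i j)%N.
  case: (posnP (m i j)) => [|m0]; [by left | right].
  rewrite ltnNge; apply/negP=> mk.
  have : (length (s i * w)%g < k + length v)%N.
    by rewrite wE; apply: (len_gen_alternating gens rels mdiag); rewrite m0.
  by rewrite -wlen ltnNge w_le_sw.
have c1 := rep_cheb rep nij k_lt.
have c0 : 0 <= chebyshev (- G i j) k.
  by apply: (rep_cheb rep nij); case: k_lt => [->|/ltnW]; [left | right].
rewrite wE (repM rep) mulmxA alternating_act.
have nonnegZ a v' : 0 <= a -> nonneg v' -> nonneg (a *: v' : 'rV[R]_n).
  by move=> a0 v'0 l; rewrite mxE mulr_ge0.
by case: (odd k); rewrite mulmxDl -!scalemxAl; apply: nonnegD; apply: nonnegZ.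
Qed.

End Positivity.

(** * Roots and parabolic subgroups *)

Section SpanRank.
Variables (R : realFieldType) (n : nat).
Implicit Types (J K : {set 'I_n}) (v : 'rV[R]_n).

Definition span_mx J : 'M[R]_(#|J|, n) := \matrix_(k < #|J|) simple R (enum_val k).

Lemma row_span_mx J k : row k (span_mx J) = simple R (enum_val k).
Proof. exact: rowK. Qed.

Lemma span_mx_orthonormal J : span_mx J *m (span_mx J)^T = 1%:M.
Proof.
apply/matrixP=> i j; rewrite !mxE (bigD1 (enum_val i)) //= big1 ?addr0.
  by rewrite !mxE !eqxx (inj_eq enum_val_inj) mul1r eq_sym.
by move=> k ki; rewrite !mxE (negbTE ki) mul0r.
Qed.

Lemma span_mx_free J : row_free (span_mx J).
Proof. by apply/row_freeP; exists (span_mx J)^T; apply: span_mx_orthonormal. Qed.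

Lemma in_spanP J v : reflect (in_span J v) (v <= span_mx J)%MS.
Proof.
apply: (iffP idP) => [/submxP[x ->] i iJ | vJ].
  rewrite mxE big1 // => k _; rewrite !mxE eqxx /=.
  by case: eqP => [ik|]; [rewrite ik enum_valP in iJ | rewrite mulr0].
rewrite (in_span_sum vJ) summx_sub // => i iJ; apply: scalemx_sub.
by rewrite -(enum_rankK_in iJ iJ) -row_span_mx row_sub.
Qed.

Lemma in_span_invmx J K (A : 'M[R]_n) : A \in unitmx -> #|J| = #|K| ->
  (forall v, in_span J v -> in_span K (v *m A)) ->
  forall v, in_span K v -> in_span J (v *m invmx A).
Proof.
move=> Au cJK AJK v vK.
have sub : (span_mx J *m A <= span_mx K)%MS.
  apply/row_subP=> k; rewrite row_mul; apply/in_spanP/AJK/in_spanP.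
  exact: row_sub.
have : (span_mx J *m A == span_mx K)%MS.
  rewrite -(geq_leqif (mxrank_leqif_eq sub)) mxrankMfree ?row_free_unit //.
  by move: (span_mx_free J) (span_mx_free K); rewrite /row_free => /eqP-> /eqP->; rewrite cJK.
move/eqmxP=> eqJK; apply/in_spanP.
have /submxP[x xv] : (v <= span_mx J *m A)%MS by rewrite eqJK; apply/in_spanP.
by rewrite xv mulmxA mulmxK // submxMl.
Qed.

End SpanRank.

Section Roots.
Variables (R : archiRealFieldType) (W : groupType) (n : nat).
Variables (s : 'I_n -> W) (m : 'I_n -> 'I_n -> nat).
Variables (G : 'M[R]_n) (rho : W -> 'M[R]_n).
Hypothesis rep : reflection_rep s m G rho.
Local Notation e := (simple R).
Local Notation B := (form G).
Let gens := rep_spans rep.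
Let rels := rep_rel rep.
Let mdiag := rep_mdiag rep.
Local Notation length := (len gens).
Implicit Types (i j : 'I_n) (u v : 'rV[R]_n) (w : W) (J K : {set 'I_n}).

Lemma word_ind (P : W -> Prop) :
  P 1%g -> (forall i w, P w -> P (s i * w)%g) -> forall w, P w.
Proof.
move=> P1 PM w; have [u <-] := gens w; elim: u => [|i u IHu].
  by rewrite gen_prod_nil.
by rewrite gen_prod_cons; apply: PM.
Qed.

Lemma rhoK w : rho w *m rho w^-1%g = 1%:M.
Proof. by rewrite -(repM rep) mulgV (rep1 rep). Qed.

Lemma rhoVK w : rho w^-1%g *m rho w = 1%:M.
Proof. by rewrite -(repM rep) mulVg (rep1 rep). Qed.

Lemma rho_unit w : rho w \in unitmx.
Proof. by case: (mulmx1_unit (rhoK w)). Qed.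

Lemma rho_inv w : invmx (rho w) = rho w^-1%g.
Proof. by rewrite -[LHS]mulmx1 -(rhoK w) mulmxA mulVmx ?mul1mx ?rho_unit. Qed.

Lemma act1 v : v *m rho 1%g = v.
Proof. by rewrite (rep1 rep) mulmx1. Qed.

Lemma actM v w w' : v *m rho (w * w')%g = v *m rho w *m rho w'.
Proof. by rewrite (repM rep) mulmxA. Qed.

Lemma actK w v : v *m rho w *m rho w^-1%g = v.
Proof. by rewrite -mulmxA rhoK mulmx1. Qed.

Lemma actKV w v : v *m rho w^-1%g *m rho w = v.
Proof. by rewrite -mulmxA rhoVK mulmx1. Qed.

Lemma B_act w u v : B (u *m rho w) (v *m rho w) = B u v.
Proof.
elim/word_ind: w u v => [|i w IHw] u v; first by rewrite !act1.
rewrite !actM IHw !(rho_gen rep) !(formDl, formDr, formNl, formNr, formZl, formZr).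
rewrite (B_simple rep) (B_sym rep (e i) v); ring.
Qed.

Lemma simple_act_sign i w : nonneg (e i *m rho w) \/ nonneg (- (e i *m rho w)).
Proof.
have [le_w|lt_w] := leqP (length w) (length (s i * w)%g); [left|right].
  exact: (nonneg_of_len le_w).
rewrite -mulNmx -(rho_gen_simple rep) -actM; apply: (nonneg_of_len (rep := rep)).
by rewrite (gen_mulK rels mdiag) ltnW.
Qed.

Definition root v := exists i w, v = e i *m rho w.

Lemma root_act v w : root v -> root (v *m rho w).
Proof. by case=> i [w' ->]; exists i, (w' * w)%g; rewrite actM. Qed.

Lemma root_simple i : root (e i).
Proof. by exists i, 1%g; rewrite act1. Qed.

Lemma root_opp v : root v -> root (- v).
Proof.
case=> i [w ->]; exists i, (s i * w)%g.
by rewrite actM (rho_gen_simple rep) mulNmx.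
Qed.

Lemma root_sign v : root v -> nonneg v \/ nonneg (- v).
Proof. by case=> i [w ->]; apply: simple_act_sign. Qed.

Lemma root_norm v : root v -> B v v = 2.
Proof. by case=> i [w ->]; rewrite B_act (B_simple rep). Qed.

Lemma root_neq0 v : root v -> v != 0.
Proof.
move=> rv; apply/eqP=> v0; have /eqP := root_norm rv.
by rewrite v0 form0l eq_sym pnatr_eq0.
Qed.

Lemma nonneg_root v i : root v -> 0 < v 0 i -> nonneg v.
Proof.
move=> rv vi; case: (root_sign rv) => // /(_ i).
by rewrite mxE oppr_ge0 leNgt vi.
Qed.

Lemma root_scale_simple c i : 0 < c -> root (c *: e i) -> c = 1.
Proof.
move=> c0 /root_norm; rewrite formZl formZr (B_simple rep) => cc2.
have : (c - 1) * (c + 1) = 0 by lra.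
move/eqP; rewrite mulf_eq0 subr_eq0 => /orP[/eqP // | /eqP]; lra.
Qed.

Lemma faithful w : (forall i, nonneg (e i *m rho w)) -> w = 1%g.
Proof.
move=> w0; apply: contrapT => /eqP w1.
have [i iw] := descent gens rels mdiag w1.
have : e i *m rho w = 0.
  apply: nonneg_antisym => //.
  rewrite -mulNmx -(rho_gen_simple rep) -actM.
  by apply: (nonneg_of_len (rep := rep)); rewrite (gen_mulK rels mdiag) ltnW.
by apply/eqP; apply: root_neq0; exists i, w.
Qed.

Lemma act_inj w w' : (forall v, v *m rho w = v *m rho w') -> w = w'.
Proof.
move=> ww'; apply: (mulIg w'^-1%g); rewrite mulgV; apply: faithful => i.
by rewrite actM ww' actK; apply: nonneg_simple.
Qed.

Lemma reflection_act v i w :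
  v *m rho (s i ^ w)%g = v - B v (e i *m rho w) *: (e i *m rho w).
Proof.
rewrite conjgE !actM (rho_gen rep) mulmxBl actKV -scalemxAl.
by have := B_act w (v *m rho w^-1%g) (e i); rewrite actKV => ->.
Qed.

Lemma reflection_eq i j w w' c :
  c ^+ 2 = 1 -> e i *m rho w = c *: (e j *m rho w') -> (s i ^ w = s j ^ w')%g.
Proof.
move=> c2 ij; apply: act_inj => v; rewrite !reflection_act ij formZr scalerA.
by rewrite -mulrA mulrCA -expr2 c2 mulr1.
Qed.

Definition parabolic J w := exists2 u, all (mem J) u & gen_prod s u = w.

Lemma parabolic1 J : parabolic J 1%g.
Proof. by exists [::] => //; rewrite gen_prod_nil. Qed.

Lemma parabolicM J w w' : parabolic J w -> parabolic J w' -> parabolic J (w * w')%g.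
Proof.
case=> [u uJ <-] [u' u'J <-]; exists (u ++ u'); rewrite ?gen_prod_cat //.
by rewrite all_cat uJ.
Qed.

Lemma parabolic_gen J i : i \in J -> parabolic J (s i).
Proof.
by move=> iJ; exists [:: i]; rewrite /= ?iJ // gen_prod_cons gen_prod_nil mulg1.
Qed.

Lemma parabolicV J w : parabolic J w -> parabolic J w^-1%g.
Proof.
case=> u uJ <-; exists (rev u); first by rewrite all_rev.
exact: (gen_prod_rev rels mdiag).
Qed.

Lemma parabolic_sub J v w : parabolic J w -> in_span J (v *m rho w - v).
Proof.
case=> u uJ <-; elim: u v uJ => [|i u IHu] v /=.
  by rewrite gen_prod_nil act1 subrr => _; apply: in_span0.
case/andP=> iJ uJ; rewrite gen_prod_cons actM (rho_gen rep).
rewrite -(subrK (v - B v (e i) *: e i) (_ *m _)) -addrA.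
apply: in_spanD; first exact: IHu.
rewrite addrAC subrr add0r; apply: in_spanN; apply: in_spanZ.
exact: in_span_simple.
Qed.

Lemma parabolic_span J v w : parabolic J w -> in_span J v -> in_span J (v *m rho w).
Proof.
by move=> Jw vJ; rewrite -(subrK v (_ *m _)); apply: in_spanD => //; apply: parabolic_sub.
Qed.

(** Choosing [u * w] of minimal length leaves it without descents in [J]. *)
Lemma minimal_coset_rep J w :
  exists2 u, parabolic J u & forall j, j \in J -> nonneg (e j *m rho (u * w)%g).
Proof.
pose P k := `[< exists2 u, parabolic J u & length (u * w)%g = k >].
have exP : exists k, P k.
  by exists (length w); apply/asboolP; exists 1%g; rewrite ?mul1g //; apply: parabolic1.
case: (ex_minnP exP) => k /asboolP[u Ju uk] kmin; exists u => // j jJ.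
apply: (nonneg_of_len (rep := rep)); rewrite uk mulgA; apply: kmin; apply/asboolP.
by exists (s j * u)%g => //; apply: parabolicM => //; apply: parabolic_gen.
Qed.

Definition height v : R := \sum_i v 0 i.

Lemma heightD u v : height (u + v) = height u + height v.
Proof. by rewrite -big_split; apply: eq_bigr => i _; rewrite mxE. Qed.

Lemma heightZ c v : height (c *: v) = c * height v.
Proof. by rewrite /height mulr_sumr; apply: eq_bigr => i _; rewrite mxE. Qed.

Lemma height_simple i : height (e i) = 1.
Proof.
rewrite /height (bigD1 i) //= big1 ?addr0 => [|j ji]; rewrite simpleE ?eqxx //.
by rewrite eq_sym (negbTE ji).
Qed.

Lemma height_ge0 v : nonneg v -> 0 <= height v.
Proof. by move=> v0; apply: sumr_ge0 => i _; apply: v0. Qed.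

Lemma G_le2 i j : `|G i j| <= 2.
Proof.
rewrite ler_norml (rep_ge rep) /=; have [->|/(rep_off rep)[->|?]] := eqVneq i j.
- by rewrite (rep_diag rep).
- exact: ler0n.
- lra.
Qed.

(** As the entries of [G] are at most [2], the value [2] of the form on a root is
    at most twice the square of its height. *)
Lemma root_height v : root v -> nonneg v -> 1 <= height v.
Proof.
move=> /root_norm v2 v0; have h0 := height_ge0 v0.
have : B v v <= 2 * height v ^+ 2.
  rewrite (form_span _ _ (@in_spanT _ _ v)) expr2 {2}/height mulr_suml mulr_sumr.
  rewrite big_mkcond /=; apply: ler_sum => i _; rewrite in_setT.
  rewrite (B_sym rep) form_simpler mulrCA; apply: ler_wpM2l; first exact: v0.
  rewrite mulr_sumr; apply: ler_sum => j _; rewrite mulrC.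
  by apply: ler_wpM2r; [apply: v0 | apply: le_trans (ler_norm _) (G_le2 _ _)].
rewrite v2 => le2; rewrite leNgt; apply/negP=> h1; nra.
Qed.

(** Here [z] is the sum of the positive roots that [w^-1] makes negative.  It is
    the difference between the Weyl vector, whose pairing with [v] would be
    [height v], and its image; it exists even if the Weyl vector does not. *)
Lemma inversion_sum w :
  exists2 z, nonneg z & forall v, B z v = height v - height (v *m rho w^-1%g).
Proof.
have [N] := ubnP (length w); elim: N w => // N IHN w; rewrite ltnS => wN.
have [->|w1] := eqVneq w 1%g.
  exists 0 => [i|v]; first by rewrite mxE.
  by rewrite invg1 act1 subrr form0l.
have [i iw] := descent gens rels mdiag w1.
have [z z0 Bz] := IHN (s i * w)%g (leq_trans iw wN).
exists (z + e i *m rho (s i * w)%g) => [|v].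
  apply: nonnegD => //; apply: (nonneg_of_len (rep := rep)).
  by rewrite (gen_mulK rels mdiag) ltnW.
have -> : v *m rho w^-1%g = v *m rho (s i * w)^-1%g *m rho (s i).
  by rewrite -actM invgM (gen_inv rels mdiag) -mulgA (gen_sqr rels mdiag) mulg1.
rewrite (rho_gen rep) -[- (_ *: _)]scaleNr heightD heightZ height_simple formDl Bz.
rewrite (B_sym rep _ (e i)) -{3}(actKV (s i * w)%g v) B_act (B_sym rep (e i)); ring.
Qed.

(** Connectedness of the diagram, in the form in which it is used: a nonempty
    set that is closed under edges inside [J] exhausts [J]. *)
Definition irreducible J := forall X : {set 'I_n}, X \subset J -> X != set0 ->
  (forall x y, x \in X -> y \in J -> G x y != 0 -> y \in X) -> J \subset X.

Definition posdef J := forall z, in_span J z -> z != 0 -> 0 < B z z.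

Lemma G_sym i j : G i j = G j i.
Proof. by rewrite -[in LHS](rep_sym rep) mxE. Qed.

Lemma G_off i j : i != j -> G i j <= 0.
Proof. by case/(rep_off rep) => [->|le1] //; apply: le_trans le1 _; lra. Qed.

Lemma G_edge i j : i != j -> G i j != 0 -> G i j <= -1.
Proof. by case/(rep_off rep) => [->|] //; rewrite eqxx. Qed.

(** If a coordinate of [y] vanishes, the inequality at that vertex leaves only
    nonpositive terms, so the coordinates at all neighbours vanish too. *)
Lemma vinberg_pos J (y : 'rV[R]_n) (g := fun r => \sum_(j in J) y 0 j * G j r) r0 :
  irreducible J -> (forall r, r \in J -> 0 <= y 0 r) ->
  (forall r, r \in J -> 0 <= g r) -> r0 \in J -> 0 < g r0 ->
  forall r, r \in J -> 0 < y 0 r.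
Proof.
move=> irrJ y0 g0 r0J gr0 r rJ; rewrite lt_def y0 // andbT; apply/negP => yr.
pose X := [set x in J | y 0 x == 0].
have XJ : X \subset J by apply/subsetP=> x; rewrite inE => /andP[].
have Xr : r \in X by rewrite inE rJ.
have clX x z : x \in X -> z \in J -> G x z != 0 -> z \in X.
  rewrite !inE => /andP[xJ /eqP yx] zJ xz; rewrite zJ /=.
  have pos j : j \in J -> 0 <= - (y 0 j * G j x).
    move=> jJ; have [->|jx] := eqVneq j x; first by rewrite yx mul0r oppr0.
    by rewrite -mulrN mulr_ge0 ?y0 // oppr_ge0 G_off.
  have /eqP : \sum_(j in J) - (y 0 j * G j x) = 0.
    apply/eqP; rewrite eq_le sumr_ge0 // andbT.
    by rewrite sumrN oppr_le0; apply: g0.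
  rewrite psumr_eq0 // => /allP/(_ z).
  by rewrite mem_index_enum zJ oppr_eq0 mulf_eq0 (G_sym z) (negbTE xz) orbF => /(_ isT).
have /subsetP sJX : J \subset X by apply: irrJ clX => //; apply/set0Pn; exists r.
move: gr0; rewrite /g big1 ?ltxx // => j /sJX.
by rewrite inE => /andP[_ /eqP->]; rewrite mul0r.
Qed.

End Roots.

(** * The criterion of Vinberg and longest elements *)

Section Finiteness.
Variables (R : archiRealFieldType) (W : groupType) (n : nat).
Variables (s : 'I_n -> W) (m : 'I_n -> 'I_n -> nat).
Variables (G : 'M[R]_n) (rho : W -> 'M[R]_n).
Hypothesis rep : reflection_rep s m G rho.
Local Notation e := (simple R).
Local Notation B := (form G).
Local Notation irreducible := (irreducible G).
Local Notation posdef := (posdef G).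
Local Notation parabolic := (parabolic s).
Local Notation root := (root rho).
Implicit Types (i j : 'I_n) (u v : 'rV[R]_n) (w : W) (J K : {set 'I_n}).

Lemma vinberg_identity J (y z : 'rV[R]_n) : (forall r, r \in J -> 0 < y 0 r) -> in_span J z ->
  B z z = \sum_(r in J) ((\sum_(j in J) y 0 j * G j r) * y 0 r * (z 0 r / y 0 r) ^+ 2)
    - 2^-1 * \sum_(r in J) \sum_(j in J) G r j * y 0 r * y 0 j
        * (z 0 r / y 0 r - z 0 j / y 0 j) ^+ 2.
Proof.
move=> y0 zJ.
pose x r := z 0 r / y 0 r.
have zE r : r \in J -> z 0 r = y 0 r * x r.
  by move=> rJ; rewrite mulrC divfK // gt_eqF ?y0.
have -> : B z z = \sum_(r in J) \sum_(j in J) G r j * y 0 r * y 0 j * (x r * x j).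
  rewrite (form_span _ _ zJ); apply: eq_bigr => r rJ.
  rewrite (B_sym rep) (form_span _ _ zJ) mulr_sumr; apply: eq_bigr => j jJ.
  by rewrite form_simple (zE r) // (zE j) // (G_sym rep j); ring.
have left : \sum_(r in J) ((\sum_(j in J) y 0 j * G j r) * y 0 r * x r ^+ 2)
    = \sum_(r in J) \sum_(j in J) G r j * y 0 r * y 0 j * x r ^+ 2.
  apply: eq_bigr => r rJ; rewrite !mulr_suml; apply: eq_bigr => j jJ.
  by rewrite (G_sym rep j); ring.
have right : \sum_(r in J) \sum_(j in J) G r j * y 0 r * y 0 j * x r ^+ 2
    = \sum_(r in J) \sum_(j in J) G r j * y 0 r * y 0 j * x j ^+ 2.
  rewrite exchange_big /=; apply: eq_bigr => r rJ; apply: eq_bigr => j jJ.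
  by rewrite (G_sym rep j); ring.
rewrite [X in _ = X - _]left.
have -> : \sum_(r in J) \sum_(j in J) G r j * y 0 r * y 0 j * (x r - x j) ^+ 2 =
  \sum_(r in J) \sum_(j in J) G r j * y 0 r * y 0 j * x r ^+ 2
  + \sum_(r in J) \sum_(j in J) G r j * y 0 r * y 0 j * x j ^+ 2
  - 2 * \sum_(r in J) \sum_(j in J) G r j * y 0 r * y 0 j * (x r * x j).
  rewrite -big_split mulr_sumr -sumrB /=; apply: eq_bigr => r rJ.
  rewrite -big_split mulr_sumr -sumrB /=; apply: eq_bigr => j jJ; ring.
rewrite -right; lra.
Qed.

(** Rescaled by [y], the form becomes a sum of squares with nonnegative
    coefficients.  Irreducibility spreads the strict inequality at [r0] to all
    coordinates of an isotropic vector. *)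
Lemma vinberg J (y : 'rV[R]_n) r0 (g := fun r => \sum_(j in J) y 0 j * G j r) :
  irreducible J -> (forall r, r \in J -> 0 <= y 0 r) ->
  (forall r, r \in J -> 0 <= g r) -> r0 \in J -> 0 < g r0 -> posdef J.
Proof.
move=> irrJ y0 g0 r0J gr0; have yp := vinberg_pos rep irrJ y0 g0 r0J gr0.
move=> z zJ; apply: contraNlt => Bz.
pose a r := g r * y 0 r * (z 0 r / y 0 r) ^+ 2.
pose b r j := - (G r j * y 0 r * y 0 j * (z 0 r / y 0 r - z 0 j / y 0 j) ^+ 2).
have a0 r : r \in J -> 0 <= a r.
  by move=> rJ; rewrite mulr_ge0 ?sqr_ge0 // mulr_ge0 ?g0 ?y0.
have b0 r j : r \in J -> j \in J -> 0 <= b r j.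
  move=> rJ jJ; have [->|rj] := eqVneq r j.
    by rewrite /b subrr expr2 mul0r mulr0 oppr0.
  rewrite /b -!mulNr mulr_ge0 ?sqr_ge0 // mulr_ge0 ?y0 // mulr_ge0 ?y0 //.
  by rewrite oppr_ge0 (G_off rep).
have := vinberg_identity yp zJ; rewrite -/(g _) => Bzz.
have BzE : B z z = \sum_(r in J) a r + 2^-1 * \sum_(r in J) \sum_(j in J) b r j.
  rewrite Bzz -mulrN -sumrN; congr (_ + _ * _).
  by apply: eq_bigr => r _; rewrite -sumrN.
have suma : 0 <= \sum_(r in J) a r by apply: sumr_ge0.
have sumb : 0 <= \sum_(r in J) \sum_(j in J) b r j.
  by apply: sumr_ge0 => r rJ; apply: sumr_ge0 => j jJ; apply: b0.
have a_eq0 : \sum_(r in J) a r = 0 by lra.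
have b_eq0 : \sum_(r in J) \sum_(j in J) b r j = 0 by lra.
have z0 r : r \in J -> (z 0 r / y 0 r == 0) = (z 0 r == 0).
  by move=> rJ; rewrite mulf_eq0 invr_eq0 (gt_eqF (yp r rJ)) orbF.
have zr0 : z 0 r0 == 0.
  move/eqP: a_eq0; rewrite psumr_eq0 // => /allP/(_ r0).
  rewrite mem_index_enum r0J /a mulf_eq0 sqrf_eq0 z0 // mulf_eq0.
  by rewrite (gt_eqF gr0) (gt_eqF (yp _ r0J)) => /(_ isT).
pose X := [set x in J | z 0 x == 0].
have sJX : J \subset X.
  apply: irrJ; first by apply/subsetP=> x; rewrite inE => /andP[].
    by apply/set0Pn; exists r0; rewrite inE r0J.
  move=> x x'; rewrite !inE => /andP[xJ zx] x'J xx'; rewrite x'J /=.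
  move/eqP: b_eq0; rewrite psumr_eq0; last by move=> r rJ; apply: sumr_ge0 => j; apply: b0.
  move=> /allP/(_ x); rewrite mem_index_enum xJ => /(_ isT).
  rewrite psumr_eq0; last by move=> j; apply: b0.
  move=> /allP/(_ x'); rewrite mem_index_enum => /(_ isT).
  rewrite x'J /b oppr_eq0 mulf_eq0 sqrf_eq0 !mulf_eq0 (negbTE xx') (gt_eqF (yp _ xJ)) (gt_eqF (yp _ x'J)).
  by rewrite (eqP zx) mul0r sub0r oppr_eq0 z0.
apply/eqP/rowP=> i; rewrite mxE; have [iJ|/zJ //] := boolP (i \in J).
by have := subsetP sJX i iJ; rewrite inE => /andP[_ /eqP].
Qed.

(** The row space of [span_mx R J] carries the nondegenerate Gram matrix [GJ]. *)
Lemma dual_vector J : posdef J ->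
  exists2 f, in_span J f & forall r, r \in J -> B f (e r) = 1.
Proof.
move=> pJ; pose U := span_mx R J; pose GJ := U *m G *m U^T.
have GJu : GJ \in unitmx.
  rewrite -row_free_unit -kermx_eq0; apply/rowV0P => x /sub_kermxP xG.
  have: B (x *m U) (x *m U) = 0.
    by rewrite /form trmx_mul -!mulmxA (mulmxA U) (mulmxA (U *m G)) (mulmxA x) xG mul0mx mxE.
  have [/eqP xU0 _|xU0] := boolP (x *m U == 0).
    by rewrite -[x]mulmx1 -(span_mx_orthonormal R J) mulmxA xU0 mul0mx.
  have /pJ/(_ xU0) : in_span J (x *m U) by apply/in_spanP; apply: submxMl.
  by move=> gt0 Bx; rewrite Bx ltxx in gt0.
exists (const_mx 1 *m invmx GJ *m U) => [|r rJ].
  by apply/in_spanP; apply: submxMl.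
have -> : e r = row (enum_rank_in rJ r) U by rewrite row_span_mx enum_rankK_in.
rewrite /form rowE trmx_mul !mulmxA -(mulmxA _ U G) -(mulmxA _ (U *m G)) -/GJ mulmxKV //.
by rewrite trmx_delta -colE !mxE.
Qed.

(** A simple root of [K] is the image of a positive root, hence a nonnegative
    combination of the positive roots [e i *m A], hence one of them. *)
Lemma simple_permutation J K (A : 'M[R]_n) : A \in unitmx -> #|J| = #|K| ->
  (forall v, in_span K v -> in_span J (v *m invmx A)) ->
  (forall v, root v -> root (v *m A)) -> (forall v, root v -> root (v *m invmx A)) ->
  (forall i, i \in J -> nonneg (e i *m A)) ->
  exists sigma : 'I_n -> 'I_n, forall i, i \in J ->
    sigma i \in K /\ e i *m A = e (sigma i).
Proof.
move=> Au cJK KJ rootA rootA' A0.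
have pre j : exists i, j \in K -> i \in J /\ e i *m A = e j.
  have [jK|_] := boolP (j \in K); last by exists j.
  have vA : e j *m invmx A *m A = e j by rewrite mulmxKV.
  have vJ : in_span J (e j *m invmx A) by apply/KJ/in_span_simple.
  have rv : root (e j *m invmx A) by apply/rootA'/(root_simple rep).
  have v0 : nonneg (e j *m invmx A).
    case: (root_sign rep rv) => // nv0.
    have nej : nonneg (- e j).
      rewrite -vA -mulNmx (mul_simple_sum A (in_spanN vJ)).
      by apply: nonneg_comb => // i iJ; apply: A0.
    by have /eqP := nonneg_antisym (@nonneg_simple R _ j) nej; rewrite (negbTE (simple_neq0 _ _)).
  have [i iJ [c c0 ic]] := extremal_simple vJ v0 A0 vA.
  exists i => _; split=> //.
  have c1 : c = 1.
    by apply: (root_scale_simple rep c0 (i := j)); rewrite -ic; apply/rootA/(root_simple rep).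
  by rewrite ic c1 scale1r.
have [tau tauP] := choice pre.
have tau_inj : {in K &, injective tau}.
  by move=> i j /tauP[_ iE] /tauP[_ jE] ij; apply: (@simple_inj R); rewrite -iE ij.
have tauK : tau @: K = J.
  apply/eqP; rewrite eqEcard card_in_imset // cJK leqnn andbT.
  by apply/subsetP=> _ /imsetP[j /tauP[? _] ->].
have : forall i, exists j, i \in J -> j \in K /\ e i *m A = e j.
  move=> i; have [|_] := boolP (i \in J); last by exists i.
  by rewrite -{1}tauK => /imsetP[j jK ->]; exists j => _; split=> //; case: (tauP _ jK).
by case/choice => sigma sigmaP; exists sigma.
Qed.

(** For the dual vector [f], a step to [s r * w] with [e r *m rho w] positive
    lowers the pairing of [f *m rho w] with [f] by the height of that root,
    hence by at least [1].  By the Cauchy-Schwarz inequality the pairing is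
    bounded below, so these steps end at an element that makes all simple roots
    of [J] negative. *)
Lemma longest_element J : posdef J ->
  exists w0 (sigma : 'I_n -> 'I_n), parabolic J w0 /\
    forall i, i \in J -> sigma i \in J /\ e i *m rho w0 = - e (sigma i).
Proof.
move=> pJ; have [f fJ Bf] := dual_vector pJ.
suff [w0 Jw0 w0_neg] : exists2 w0, parabolic J w0 &
    forall i, i \in J -> nonneg (- (e i *m rho w0)).
  have negK : - rho w0 *m - rho w0^-1%g = 1%:M.
    by rewrite mulNmx mulmxN opprK (rhoK rep).
  have [uw0 _] := mulmx1_unit negK.
  have inv0 : invmx (- rho w0) = - rho w0^-1%g.
    by rewrite -[LHS]mulmx1 -negK mulmxA mulVmx // mul1mx.
  have [||||sigma sigmaP] := simple_permutation uw0 (erefl #|J|).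
  - move=> v vJ; rewrite inv0 mulmxN; apply: in_spanN.
    by apply: (parabolic_span rep) => //; apply: (parabolicV rep).
  - by move=> v rv; rewrite mulmxN; apply/(root_opp rep)/(root_act rep).
  - by move=> v rv; rewrite inv0 mulmxN; apply/(root_opp rep)/(root_act rep).
  - by move=> i iJ; rewrite mulmxN; apply: w0_neg.
  exists w0, sigma; split=> // i /sigmaP[sJ]; rewrite mulmxN => iE; split=> //.
  by rewrite -iE opprK.
have bound w : parabolic J w -> - B f f <= B (f *m rho w) f.
  move=> Jw; have fwJ := parabolic_span rep Jw fJ.
  have : 0 <= B (f *m rho w + f) (f *m rho w + f).
    have [->|nz] := eqVneq (f *m rho w + f) 0; first by rewrite form0l.
    by apply/ltW/pJ => //; apply: in_spanD.
  rewrite formDl !formDr (B_act rep) (B_sym rep f); lra.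
apply: contrapT => no_w0.
have [N NP] : exists N : nat, 2 * B f f < N%:R.
  by exists (Num.bound `|2 * B f f|); apply: le_lt_trans (ler_norm _) (archi_boundP (normr_ge0 _)).
have desc k : exists2 w, parabolic J w & B (f *m rho w) f <= B f f - k%:R.
  elim: k => [|k [w Jw Bw]].
    by exists 1%g; [apply: parabolic1 | rewrite (act1 rep) subr0].
  have [r rJ r0] : exists2 r, r \in J & ~ nonneg (- (e r *m rho w)).
    apply: contrapT => no_r; apply: no_w0; exists w => // i iJ.
    by apply: contrapT => ni; apply: no_r; exists i.
  have rpos : nonneg (e r *m rho w) by case: (simple_act_sign rep r w).
  exists (s r * w)%g; first by apply: parabolicM => //; apply: parabolic_gen.
  rewrite (actM rep) (rho_gen rep) mulmxBl -scalemxAl Bf // scale1r formDl formNl.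
  have : 1 <= B (e r *m rho w) f; last by rewrite -natr1; lra.
  have rroot : root (e r *m rho w) by exists r, w.
  have rwJ : in_span J (e r *m rho w) by apply: (parabolic_span rep Jw); apply: in_span_simple.
  rewrite (form_span _ _ rwJ); apply: le_trans (root_height rep rroot rpos) _.
  rewrite /height (bigID (mem J)) /= [X in _ + X]big1 ?addr0; last by move=> i /rwJ.
  by apply: ler_sum => i iJ; rewrite (B_sym rep) Bf // mulr1.
have [w Jw Bw] := desc N; have := bound w Jw; lra.
Qed.

End Finiteness.

(** * From root automorphisms to permutations of simple roots *)

Section Twist.
Variables (R : archiRealFieldType) (W : groupType) (n : nat).
Variables (s : 'I_n -> W) (m : 'I_n -> 'I_n -> nat).
Variables (G : 'M[R]_n) (rho : W -> 'M[R]_n) (F : 'M[R]_n).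

(** By [ra_span] the automorphism maps standard parabolic subgroups to conjugates
    of themselves. *)
Record root_automorphism : Prop := RootAutomorphism {
  ra_unit : F \in unitmx;
  ra_form : forall u v, form G (u *m F) (v *m F) = form G u v;
  ra_root : forall v, root rho v -> root rho (v *m F);
  ra_rootV : forall v, root rho v -> root rho (v *m invmx F);
  ra_span : forall J : {set 'I_n}, exists h, forall v,
    in_span J v -> in_span J (v *m F *m rho h) }.

Hypotheses (rep : reflection_rep s m G rho) (autF : root_automorphism).
Local Notation e := (simple R).
Local Notation B := (form G).
Local Notation irreducible := (irreducible G).
Local Notation posdef := (posdef G).
Local Notation parabolic := (parabolic s).
Local Notation root := (root rho).
Implicit Types (i j : 'I_n) (u v : 'rV[R]_n) (w : W) (J K : {set 'I_n}).

(** The automorphism [F] up to the action of [W] and a global sign. *)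
Definition twist (A : 'M[R]_n) :=
  exists2 c : R, c ^+ 2 = 1 & exists h, A = c *: (F *m rho h).

Lemma sign_inv (c : R) : c ^+ 2 = 1 -> c * c = 1.
Proof. by rewrite expr2. Qed.

Lemma root_sign_scale (c : R) v : c ^+ 2 = 1 -> root v -> root (c *: v).
Proof.
move/eqP; rewrite sqrf_eq1 => /orP[] /eqP->; rewrite ?scale1r // scaleN1r.
exact: (root_opp rep).
Qed.

Lemma twist_act A w : twist A -> twist (A *m rho w).
Proof.
case=> c c2 [h ->]; exists c => //; exists (h * w)%g.
by rewrite -scalemxAl -mulmxA (repM rep).
Qed.

Lemma twist_opp A : twist A -> twist (- A).
Proof. by case=> c c2 [h ->]; exists (- c); rewrite ?sqrrN //; exists h; rewrite scaleNr. Qed.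

Lemma twist_form A u v : twist A -> B (u *m A) (v *m A) = B u v.
Proof.
case=> c c2 [h ->]; rewrite -!scalemxAr formZl formZr mulrA sign_inv // mul1r.
by rewrite !mulmxA (B_act rep) (ra_form autF).
Qed.

Lemma twist_root A v : twist A -> root v -> root (v *m A).
Proof.
case=> c c2 [h ->] rv; rewrite -scalemxAr; apply: root_sign_scale => //.
by rewrite mulmxA; apply/(root_act rep)/(ra_root autF).
Qed.

Lemma twist_inverse A : twist A -> A \in unitmx /\
  exists2 c : R, c ^+ 2 = 1 & exists h, invmx A = c *: (rho h *m invmx F).
Proof.
case=> c c2 [h AE].
have AK : A *m (c *: (rho h^-1%g *m invmx F)) = 1%:M.
  rewrite AE -scalemxAl -scalemxAr scalerA sign_inv // scale1r mulmxA.
  by rewrite -(mulmxA F) (rhoK rep) mulmx1 mulmxV // (ra_unit autF).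
have [Au _] := mulmx1_unit AK; split=> //; exists c => //; exists h^-1%g.
by rewrite -[LHS]mulmx1 -AK mulmxA mulVmx // mul1mx.
Qed.

Lemma twist_unit A : twist A -> A \in unitmx.
Proof. by case/twist_inverse. Qed.

Lemma twist_rootV A v : twist A -> root v -> root (v *m invmx A).
Proof.
case/twist_inverse=> _ [c c2 [h ->]] rv; rewrite -scalemxAr; apply: root_sign_scale => //.
by rewrite mulmxA; apply/(ra_rootV autF)/(root_act rep).
Qed.

Lemma twist_simple_inj A i j k : twist A -> e i *m A = e k -> e j *m A = e k -> i = j.
Proof.
move=> tA iA jA; apply: (@simple_inj R).
by rewrite -[e i](mulmxK (twist_unit tA)) iA -jA mulmxK // twist_unit.
Qed.

(** A minimal coset representative carries the simple roots of [J] to positive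
    roots, so a root of the span of [J] that it sends to a simple root is itself
    simple. *)
Lemma simple_in_parabolic J (K : {set 'I_n}) A d : twist A ->
  (forall i, i \in K -> in_span J (e i *m A)) ->
  (forall i, i \in K -> exists j, e i *m A *m rho d = e j) ->
  exists2 u, parabolic J u &
    forall i, i \in K -> exists2 j, j \in J & e i *m A *m rho u = e j.
Proof.
move=> tA AJ Ad; have [u Ju u0] := minimal_coset_rep rep J d.
exists u^-1%g; first exact: (parabolicV rep).
move=> i iK; have [k dk] := Ad i iK.
pose v := e i *m A *m rho u^-1%g.
have vJ : in_span J v.
  by apply: (parabolic_span rep); [apply: (parabolicV rep) | apply: AJ].
have vk : v *m rho (u * d)%g = e k by rewrite (actM rep) (actKV rep).
have rv : root v by apply/(root_act rep)/twist_root/(root_simple rep).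
have v0 : nonneg v.
  case: (root_sign rep rv) => // nv0.
  have nek : nonneg (- e k).
    rewrite -vk -mulNmx (mul_simple_sum _ (in_spanN vJ)).
    by apply: nonneg_comb => // j; apply: u0.
  by have /eqP := nonneg_antisym (@nonneg_simple R _ k) nek; rewrite (negbTE (simple_neq0 _ _)).
have [j jJ [c c0 jc]] := extremal_simple vJ v0 u0 vk.
exists j => //; rewrite -/v -[v](actK rep (u * d)%g) vk.
have c1 : c = 1.
  by apply: (root_scale_simple rep c0 (i := k)); rewrite -jc; apply/(root_act rep)/(root_simple rep).
by rewrite -[e k]scale1r -c1 -jc (actK rep).
Qed.

Lemma span_extend (J : {set 'I_n}) (A : 'M[R]_n) t v :
  (forall i, i \in J -> in_span t (e i *m A)) -> in_span J v -> in_span t (v *m A).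
Proof. by move=> AJ vJ; rewrite (mul_simple_sum A vJ); apply: in_span_comb. Qed.

Lemma irreducible_image J A (tau : 'I_n -> 'I_n) : twist A ->
  (forall i, i \in J -> e i *m A = e (tau i)) ->
  irreducible J -> irreducible (tau @: J).
Proof.
move=> tA tauA irrJ X XJ /set0Pn[x xX] clX.
have /imsetP[i iJ xi] := subsetP XJ x xX.
have sJ : J \subset [set j in J | tau j \in X].
  apply: irrJ.
  - by apply/subsetP=> j; rewrite inE => /andP[].
  - by apply/set0Pn; exists i; rewrite inE iJ -xi.
  move=> j k; rewrite !inE => /andP[jJ jX] kJ jk; rewrite kJ.
  apply: clX jX _ _; first exact: imset_f.
  by rewrite -form_simple -!tauA // twist_form // form_simple.
apply/subsetP=> _ /imsetP[j /(subsetP sJ) jX ->].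
by move: jX; rewrite inE => /andP[].
Qed.

Definition simple_twist J := exists2 A, twist A & exists sigma : 'I_n -> 'I_n,
  forall i, i \in J -> sigma i \in J /\ e i *m A = e (sigma i).

(** After a change by [W] the twist preserves the span of the larger set and still
    sends the old simple roots to simple roots.  If the new simple root goes to
    a positive root, all simple roots stay positive and so are permuted.  If it
    goes to the negative root [- y], then [y] satisfies the inequalities of
    [vinberg] on the image [K] of the old part.  The longest element of [K],
    together with the sign [-1], then keeps the old simple roots simple and
    makes the new root positive. *)
Lemma simple_twist_extend J i0 p : irreducible J -> i0 \notin J -> p \in J ->
  G i0 p != 0 -> simple_twist J -> simple_twist (i0 |: J).
Proof.
set J1 := i0 |: J => irrJ i0J pJ Gp [A0 tA0 [sigma0 A0E]].
have sJJ1 : J \subset J1 by apply: subsetU1.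
have i0J1 : i0 \in J1 by apply: setU11.
have cJ1 : #|J1| = #|J|.+1 by rewrite cardsU1 i0J.
have [h hJ1] := ra_span autF J1.
have [A tA [AJ1 Asimple]] : exists2 A, twist A &
   (forall v, in_span J1 v -> in_span J1 (v *m A)) /\
   forall i, i \in J -> exists2 j, j \in J1 & e i *m A = e j.
  case: tA0 A0E => c c2 [h0 ->] A0E.
  have tB : twist (c *: (F *m rho h)) by exists c => //; exists h.
  have BJ1 v : in_span J1 v -> in_span J1 (v *m (c *: (F *m rho h))).
    by move=> vJ; rewrite -scalemxAr mulmxA; apply/in_spanZ/hJ1.
  have [||u Ju uE] := @simple_in_parabolic J1 J _ (h^-1 * h0)%g tB.
  - by move=> i iJ; apply/BJ1/in_span_simple/(subsetP sJJ1).
  - move=> i /A0E[_ iE]; exists (sigma0 i); rewrite -iE (actM rep).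
    by rewrite -!scalemxAr -!scalemxAl !mulmxA (actK rep).
  exists (c *: (F *m rho h) *m rho u); first exact: twist_act.
  split=> [v /BJ1 vJ|i /uE[j jJ1 ij]].
    by rewrite mulmxA; apply: (parabolic_span rep).
  by exists j; rewrite // mulmxA.
have : forall i, exists j, i \in J -> j \in J1 /\ e i *m A = e j.
  move=> i; have [/Asimple[j jJ1 ij]|_] := boolP (i \in J); last by exists i.
  by exists j.
case/choice=> tau tauP; set K := tau @: J.
have tauE i : i \in J -> e i *m A = e (tau i) by case/tauP.
have tau_inj : {in J &, injective tau}.
  move=> i j /tauE iE /tauE jE ij; rewrite ij in iE.
  exact: twist_simple_inj tA iE jE.
have sKJ1 : K \subset J1 by apply/subsetP=> _ /imsetP[i /tauP[? _] ->].
have cK : #|K| = #|J| by rewrite card_in_imset.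
have [t] : exists t, t \in J1 :\: K.
  apply/set0Pn; rewrite -card_gt0 cardsD (setIidPr sKJ1) cK cJ1.
  by rewrite subSn // subnn.
rewrite inE => /andP[tK tJ1].
have J1E : J1 = t |: K.
  apply/esym/eqP; rewrite eqEcard cardsU1 tK cK cJ1 leqnn andbT.
  by apply/subsetP=> i; rewrite in_setU1 => /orP[/eqP->|/(subsetP sKJ1)].
suff [C tC [CJ1 C0]] : exists2 C, twist C &
   (forall v, in_span J1 v -> in_span J1 (v *m C)) /\
   forall i, i \in J1 -> nonneg (e i *m C).
  exists C => //; apply: (simple_permutation rep) => //.
  - exact: twist_unit.
  - exact: in_span_invmx (twist_unit tC) _ CJ1.
  - by move=> v; apply: twist_root.
  - by move=> v; apply: twist_rootV.
have ri0 : root (e i0 *m A) by apply/twist_root/(root_simple rep).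
case: (root_sign rep ri0) => [pos|neg].
  exists A => //; split=> // i; rewrite !inE => /orP[/eqP->//|iJ].
  by rewrite tauE //; apply: nonneg_simple.
set y := - (e i0 *m A) in neg.
have yJ1 : in_span J1 y by apply/in_spanN/AJ1/in_span_simple.
(* Otherwise the image of the span of [J1] would miss [e t]. *)
have yt : 0 < y 0 t.
  rewrite lt_def neg andbT; apply/eqP=> yt0.
  have vK v : in_span J1 v -> in_span K (v *m A).
    move=> vJ; apply: span_extend vJ => i; rewrite !inE => /orP[/eqP->|iJ].
      rewrite -[_ *m A]opprK -/y; apply: in_spanN => k kK.
      have [->//|kt] := eqVneq k t; apply: yJ1.
      by rewrite J1E !inE negb_or kt.
    by rewrite tauE //; apply/in_span_simple/imset_f.
  have et : in_span J1 (e t *m invmx A).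
    exact/(in_span_invmx (twist_unit tA) _ AJ1)/in_span_simple.
  have /vK/(_ t tK) := et; rewrite mulmxKV ?twist_unit // simpleE eqxx.
  by move/eqP; rewrite oner_eq0.
have posK : posdef K.
  have By i : i \in J -> B y (e (tau i)) = - G i0 i.
    by move=> iJ; rewrite formNl -tauE // twist_form // form_simple.
  have gE r : r \in K -> \sum_(j in K) y 0 j * G j r = B y (e r) - y 0 t * G t r.
    move=> rK; rewrite (form_span _ _ yJ1) J1E big_setU1 //= form_simple; move: (y 0 t * G t r) => z; rewrite addrAC subrr add0r.
    by apply: eq_bigr => j _; rewrite form_simple.
  have yG r : r \in K -> 0 <= - (y 0 t * G t r).
    move=> rK; rewrite -mulrN mulr_ge0 ?neg // oppr_ge0 (G_off rep) //.
    by apply: contraNneq tK => ->.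
  have n0 i : i \in J -> i0 != i by move=> iJ; apply: contraNneq i0J => ->.
  apply: (vinberg rep (y := y) (r0 := tau p)).
  - exact: irreducible_image tA tauE irrJ.
  - by move=> r _; apply: neg.
  - move=> r rK; rewrite gE // addr_ge0 ?yG //.
    have /imsetP[i iJ ->] := rK; rewrite By // oppr_ge0 (G_off rep) //.
    exact: n0.
  - exact: imset_f.
  have pK : tau p \in K by apply: imset_f.
  rewrite gE // By //; apply: ltr_wpDr; first exact: yG.
  by rewrite oppr_gt0; apply: le_lt_trans (G_edge rep (n0 p pJ) Gp) _; lra.
have [w0 [opp [Kw0 w0E]]] := longest_element rep posK.
exists (- (A *m rho w0)); first exact/twist_opp/twist_act.
split=> [v vJ1|i].
  rewrite mulmxN mulmxA; apply/in_spanN/(parabolic_span rep); last exact: AJ1.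
  by case: Kw0 => u uK <-; exists u => //; apply: sub_all uK => i; apply: (subsetP sKJ1).
rewrite !inE => /orP[/eqP->|iJ].
  rewrite mulmxN mulmxA -mulNmx -/y; apply: (nonneg_root rep (i := t)).
    by apply/(root_act rep)/(root_opp rep).
  rewrite -[y *m _](subrK y) mxE (parabolic_sub rep y Kw0 tK) add0r.
  exact: yt.
have [_ iE] := w0E _ (imset_f tau iJ).
by rewrite mulmxN mulmxA tauE // iE opprK; apply: nonneg_simple.
Qed.

Definition closed_under_edges J := forall i j, i \in J -> j \notin J -> G i j = 0.

Lemma irreducible1 i : irreducible [set i].
Proof.
move=> X; rewrite subset1 => /orP[/eqP-> //|/eqP->]; by rewrite eqxx.
Qed.

Lemma irreducibleU1 J i p : irreducible J -> p \in J -> G i p != 0 ->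
  irreducible (i |: J).
Proof.
move=> irrJ pJ Gip X XJ /set0Pn[x xX] clX.
have step : (exists2 y, y \in X & y \in J) -> i |: J \subset X.
  case=> y yX yJ; have sJX : J \subset X.
    suff /subset_trans : J \subset X :&: J by apply; apply: subsetIl.
    apply: irrJ; first exact: subsetIr.
      by apply/set0Pn; exists y; rewrite inE yX.
    move=> a b; rewrite !inE => /andP[aX aJ] bJ ab; rewrite bJ andbT.
    by apply: clX ab => //; rewrite inE bJ orbT.
  rewrite subUset sJX andbT sub1set; apply: (clX p); last by rewrite (G_sym rep).
    exact: (subsetP sJX).
  by rewrite setU11.
have := subsetP XJ x xX; rewrite !inE => /orP[/eqP xi|xJ]; last by apply: step; exists x.
apply: step; exists p => //; apply: (clX x) => //; last by rewrite xi.
by rewrite inE pJ orbT.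
Qed.

Lemma simple_twist1 i : simple_twist [set i].
Proof.
have [h hi] := ra_span autF [set i].
have i1 : i \in [set i] by rewrite inE.
have t1 : twist (F *m rho h) by exists 1; rewrite ?expr1n //; exists h; rewrite scale1r.
have /in_span_sum := hi _ (in_span_simple R i1).
rewrite big_set1 -mulmxA; set a := (_ *m _ : 'rV_n) 0 i => ia.
have ra : root (a *: e i) by rewrite -ia; apply/twist_root/(root_simple rep).
have a0 : a != 0 by apply/eqP=> a0; have := root_neq0 rep ra; rewrite a0 scale0r eqxx.
have [agt|alt] := boolP (0 < a).
  exists (F *m rho h) => //; exists id => j; rewrite inE => /eqP->.
  by rewrite ia (root_scale_simple rep agt ra) scale1r.
have ngt : 0 < - a by rewrite oppr_gt0 lt_neqAle a0 leNgt.
exists (- (F *m rho h)); first exact: twist_opp.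
exists id => j; rewrite inE => /eqP->; split=> //.
have rna : root (- a *: e i) by rewrite scaleNr; apply: (root_opp rep).
by rewrite mulmxN ia -scaleNr (root_scale_simple rep ngt rna) scale1r.
Qed.

Lemma component_twist i : exists2 J : {set 'I_n}, i \in J &
  [/\ irreducible J, closed_under_edges J & simple_twist J].
Proof.
pose P (J : {set 'I_n}) := `[< [/\ i \in J, irreducible J & simple_twist J] >].
have P1 : P [set i].
  by apply/asboolP; split; [rewrite inE | apply: irreducible1 | apply: simple_twist1].
have [J /maxsetP[/asboolP[iJ irrJ tJ] maxJ] _] := maxset_exists P1.
exists J => //; split=> // a b aJ bJ; apply/eqP; apply: contraT => ab.
have ba : G b a != 0 by rewrite (G_sym rep).
have : P (b |: J).
  apply/asboolP; split; first by rewrite inE iJ orbT.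
    exact: irreducibleU1 irrJ aJ ba.
  exact: simple_twist_extend irrJ bJ aJ ba tJ.
by move/maxJ => /(_ (subsetUr _ _)) bJE; rewrite -bJE setU11 in bJ.
Qed.

End Twist.

(** * The diagram automorphism moves a vertex only to its opposite *)

Section Opposition.
Variables (R : archiRealFieldType) (W : groupType) (n : nat).
Variables (s : 'I_n -> W) (m : 'I_n -> 'I_n -> nat).
Variables (G : 'M[R]_n) (rho : W -> 'M[R]_n) (F : 'M[R]_n).
Hypotheses (rep : reflection_rep s m G rho) (autF : root_automorphism G rho F).
Local Notation e := (simple R).
Local Notation B := (form G).
Local Notation irreducible := (irreducible G).
Local Notation posdef := (posdef G).
Local Notation parabolic := (parabolic s).
Local Notation root := (root rho).
Local Notation closed := (closed_under_edges G).
Local Notation twist := (twist rho F).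
Implicit Types (i j : 'I_n) (u v : 'rV[R]_n) (w : W) (J K : {set 'I_n}).

Lemma closed_setC J : closed J -> closed (~: J).
Proof.
by move=> clJ i j; rewrite !inE negbK => iJ jJ; rewrite (G_sym rep) clJ.
Qed.

Lemma closed_form0 J u v : closed J -> in_span J u -> in_span (~: J) v -> B u v = 0.
Proof.
move=> clJ uJ vJ; rewrite (form_span _ _ uJ) big1 // => i iJ.
rewrite (B_sym rep) (form_span _ _ vJ) big1 ?mulr0 // => j; rewrite inE => jJ.
by rewrite form_simple (G_sym rep) clJ // mulr0.
Qed.

Lemma closed_span J v w : closed J -> in_span J v -> in_span J (v *m rho w).
Proof.
move=> clJ; elim/(word_ind rep): w v => [|i w IHw] v vJ; first by rewrite (act1 rep).
rewrite (actM rep); apply: IHw; rewrite (rho_gen rep).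
have [iJ|iJ] := boolP (i \in J).
  by apply/in_spanD/in_spanN/in_spanZ/in_span_simple.
rewrite (closed_form0 clJ vJ) ?scale0r ?subr0 //.
by apply: in_span_simple; rewrite inE.
Qed.

Lemma closed_fix J v w : closed J -> parabolic J w -> in_span (~: J) v -> v *m rho w = v.
Proof.
move=> clJ [u uJ <-] vJ; elim: u uJ => [|i u IHu] /=.
  by rewrite gen_prod_nil (act1 rep).
case/andP=> iJ uJ; rewrite gen_prod_cons (actM rep) (rho_gen rep) (B_sym rep).
by rewrite (closed_form0 clJ (in_span_simple _ iJ) vJ) scale0r subr0 IHu.
Qed.

Section Component.
Variables (J : {set 'I_n}) (C : 'M[R]_n) (sigma : 'I_n -> 'I_n).
Hypotheses (clJ : closed J) (irrJ : irreducible J) (tC : twist C).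
Hypothesis sigmaP : forall i, i \in J -> sigma i \in J /\ e i *m C = e (sigma i).

Let sigmaJ i : i \in J -> sigma i \in J. Proof. by case/sigmaP. Qed.
Let sigmaE i : i \in J -> e i *m C = e (sigma i). Proof. by case/sigmaP. Qed.

Lemma sigma_inj : {in J &, injective sigma}.
Proof.
move=> i j /sigmaE iE /sigmaE jE ij; rewrite ij in iE.
exact: (twist_simple_inj rep autF tC iE jE).
Qed.

(** The span of all simple roots but [e i] is preserved up to [W] by [F], while
    [C], which is [F] up to [W] and sign, maps it to the span of all simple
    roots but [e (sigma i)].  So some [k] in [W] relates the two spans, and it
    can be taken minimal in its coset. *)
Lemma maximal_parabolic_conj i : i \in J -> exists k,
  (forall v, in_span (~: [set i]) v -> in_span (~: [set sigma i]) (v *m rho k)) /\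
  forall j, j != i -> nonneg (e j *m rho k).
Proof.
move=> iJ; set L := ~: [set i]; set T := ~: [set sigma i].
have CT v : in_span L v -> in_span T (v *m C).
  apply: span_extend => j; rewrite !inE => ji; have [jJ|jJ] := boolP (j \in J).
    rewrite sigmaE //; apply: in_span_simple; rewrite !inE.
    by apply: contra ji => /eqP/sigma_inj->.
  apply: (@in_spanS _ _ (~: J)).
    by apply/subsetP=> k; rewrite !inE; apply: contra => /eqP->; apply: sigmaJ.
  case: tC => c c2 [h ->]; rewrite -scalemxAr mulmxA; apply/in_spanZ/closed_span.
    exact: closed_setC.
  have [h' hJ] := ra_span autF (~: J).
  have : in_span (~: J) (e j *m F *m rho h') by apply/hJ/in_span_simple; rewrite inE.
  by move/(closed_span h'^-1 (closed_setC clJ)); rewrite (actK rep).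
have [h hL] := ra_span autF L.
have t1 : twist (F *m rho h) by exists 1; rewrite ?expr1n //; exists h; rewrite scale1r.
have hLV := in_span_invmx (twist_unit rep autF t1) (erefl #|L|).
case: tC CT => c c2 [h0 CE] CT.
have dT v : in_span L v -> in_span T (v *m rho (h^-1 * h0)%g).
  move=> vL; rewrite -(mulmxKV (twist_unit rep autF t1) v).
  set v' := v *m _; have v'L : in_span L v'.
    by apply: hLV vL => x xL; rewrite mulmxA; apply: hL.
  rewrite (actM rep) mulmxA (actK rep).
  have -> : v' *m F *m rho h0 = c *: (v' *m C).
    by rewrite CE -scalemxAr scalerA -expr2 c2 scale1r mulmxA.
  exact/in_spanZ/CT.
have [u Lu u0] := minimal_coset_rep rep L (h^-1 * h0)%g.
exists (u * (h^-1 * h0))%g; split=> [v vL|j ji]; last by apply: u0; rewrite !inE.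
by rewrite (actM rep); apply/dT/(parabolic_span rep).
Qed.

Let not_in_span i : ~ in_span (~: [set i]) (e i).
Proof.
by move/(_ i); rewrite !inE eqxx simpleE eqxx => /(_ isT)/eqP; rewrite oner_eq0.
Qed.

Let span_image_eq i j : (forall v, in_span (~: [set i]) v -> in_span (~: [set j]) v) -> j = i.
Proof.
move=> ij; apply/eqP; apply: contraT => ji; case: (@not_in_span j); apply: ij.
by apply: in_span_simple; rewrite !inE.
Qed.

Lemma coef_moved i j k : (forall v, in_span (~: [set i]) v -> in_span (~: [set j]) (v *m rho k)) ->
  (e i *m rho k) 0 j != 0.
Proof.
move=> kij; apply/eqP=> ij0.
have all v : in_span (~: [set j]) (v *m rho k).
  rewrite [v]simple_sum mulmx_suml.
  under eq_bigr => l _ do rewrite -scalemxAl.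
  apply: in_span_comb => l _; have [->|li] := eqVneq l i; last first.
    by apply/kij/in_span_simple; rewrite !inE.
  by move=> x; rewrite !inE negbK => /eqP->.
by have := all (e j *m rho k^-1%g); rewrite (actKV rep); apply: not_in_span.
Qed.

(** As [sigma i != i], the element [k] is nontrivial.  It sends the simple roots
    other than [e i] to simple roots and [e i] to a negative root, so it negates
    all positive roots outside the span of the former.  The sum [z] of these
    roots is orthogonal to all simple roots but [e i], with which its pairing is
    positive, and [vinberg] applies to it. *)
Lemma posdef_of_moved i : i \in J -> sigma i != i -> posdef J.
Proof.
move=> iJ si; have [k [kLT k0]] := maximal_parabolic_conj iJ.
set L := ~: [set i] in kLT; set T := ~: [set sigma i] in kLT.
have ki_neg : nonneg (- (e i *m rho k)).
  case: (simple_act_sign rep i k) => // ki; case/eqP: si.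
  have k1 : k = 1%g.
    by apply: (faithful rep) => j; have [->|] := eqVneq j i; [apply: ki | apply: k0].
  by apply: span_image_eq => v /kLT; rewrite k1 (act1 rep).
have cLT : #|L| = #|T| by rewrite !cardsC1.
have [||||tau tauP] := simple_permutation rep (rho_unit rep k) cLT.
- exact: in_span_invmx (rho_unit rep k) cLT kLT.
- by move=> v rv; apply: (root_act rep).
- by move=> v rv; rewrite (rho_inv rep); apply: (root_act rep).
- by move=> j; rewrite !inE; apply: k0.
have [z z0 Bz] := inversion_sum rep k^-1%g; rewrite invgK in Bz.
have BzL j : j != i -> B z (e j) = 0.
  move=> ji; have jL : j \in L by rewrite !inE.
  by have [_ jE] := tauP j jL; rewrite Bz jE !height_simple subrr.
have Bzi : 0 < B z (e i).
  rewrite Bz height_simple; have := height_ge0 ki_neg.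
  by rewrite -scaleN1r heightZ; lra.
have gE r : r \in J -> \sum_(j in J) z 0 j * G j r = B z (e r).
  move=> rJ; rewrite form_simpler [RHS](bigID (mem J)) /= [X in _ = _ + X]big1 ?addr0 //.
  by move=> j jJ; rewrite (G_sym rep) clJ ?mulr0.
apply: (vinberg rep (y := z) (r0 := i)) => //.
- by move=> r rJ; rewrite gE //; have [->|/BzL->] := eqVneq r i; rewrite // ltW.
- by rewrite gE.
Qed.

Variables (w0 : W) (opp : 'I_n -> 'I_n).
Hypotheses (Jw0 : parabolic J w0).
Hypothesis oppP : forall i, i \in J -> opp i \in J /\ e i *m rho w0 = - e (opp i).

Let oppJ i : i \in J -> opp i \in J. Proof. by case/oppP. Qed.
Let oppE i : i \in J -> e i *m rho w0 = - e (opp i). Proof. by case/oppP. Qed.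

Lemma opp_inj : {in J &, injective opp}.
Proof.
move=> i j iJ jJ ij; apply: (@simple_inj R).
by rewrite -[e i](actK rep w0) oppE // ij -oppE // (actK rep).
Qed.

Lemma w0_fix i : i \notin J -> e i *m rho w0 = e i.
Proof. by move=> iJ; apply: closed_fix clJ Jw0 _; apply: in_span_simple; rewrite inE. Qed.

Lemma w0_sqr : (w0 * w0)%g = 1%g.
Proof.
apply: (faithful rep) => i; rewrite (actM rep).
have [iJ|iJ] := boolP (i \in J); last by rewrite !w0_fix //; apply: nonneg_simple.
by rewrite oppE // mulNmx oppE ?oppJ // opprK; apply: nonneg_simple.
Qed.

Lemma oppK i : i \in J -> opp (opp i) = i.
Proof.
move=> iJ; apply: (@simple_inj R).
by rewrite -[RHS](act1 rep) -w0_sqr (actM rep) oppE // mulNmx oppE ?oppJ // opprK.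
Qed.

Lemma opp_form i j : i \in J -> j \in J -> G (opp i) (opp j) = G i j.
Proof.
move=> iJ jJ; rewrite -!form_simple -(B_act rep w0 (e i)) !oppE //.
by rewrite formNl formNr opprK.
Qed.

Lemma sigma_form i j : i \in J -> j \in J -> G (sigma i) (sigma j) = G i j.
Proof. by move=> iJ jJ; rewrite -!form_simple -!sigmaE // (twist_form rep autF). Qed.

Lemma nonneg_w0 v : in_span J v -> nonneg (- v) -> nonneg (v *m rho w0).
Proof.
move=> vJ v0; rewrite (mul_simple_sum _ vJ).
rewrite (eq_bigr (fun i => (- v) 0 i *: e (opp i))); last first.
  by move=> i iJ; rewrite oppE // mxE scalerN scaleNr.
by apply: nonneg_comb => i _; [apply: v0 | apply: nonneg_simple].
Qed.

(** If [k] is nontrivial, it negates the positive roots outside the span of the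
    simple roots other than [e i], and [w0] makes them positive again.  Up to a
    factor in that maximal parabolic subgroup, [k * w0] keeps all simple roots
    positive, hence is [1]. *)
Lemma sigma_id_or_opp i : i \in J -> sigma i = i \/ sigma i = opp i.
Proof.
move=> iJ; have [k [kLT k0]] := maximal_parabolic_conj iJ.
case: (simple_act_sign rep i k) => ki.
  left; apply: span_image_eq => v /kLT.
  have -> : k = 1%g.
    by apply: (faithful rep) => j; have [->|] := eqVneq j i; [apply: ki | apply: k0].
  by rewrite (act1 rep).
right; apply: opp_inj; rewrite ?sigmaJ ?oppJ // oppK //.
set L := ~: [set i] in kLT; set T := ~: [set sigma i] in kLT.
have w0T v : in_span T v -> in_span (~: [set opp (sigma i)]) (v *m rho w0).
  apply: span_extend => j; rewrite !inE => ji; have [jJ|jJ] := boolP (j \in J).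
    rewrite oppE //; apply/in_spanN/in_span_simple; rewrite !inE.
    by apply: contra ji => /eqP/opp_inj-> //; apply: sigmaJ.
  rewrite w0_fix //; apply: in_span_simple; rewrite !inE.
  by apply: contraNneq jJ => ->; apply/oppJ/sigmaJ.
have [u Lu u0] := minimal_coset_rep rep L (k * w0)%g.
have aL : in_span L (e i *m rho u - e i) := parabolic_sub rep (e i) Lu.
set a := e i *m rho u in aL.
have ak_neg : nonneg (- (a *m rho k)).
  have ra : root (a *m rho k) by apply: (root_act rep); exists i, u.
  have -> : - (a *m rho k) = (- 1 : R) *: (a *m rho k) by rewrite scaleN1r.
  case: (root_sign rep ra) => [pos|]; last by rewrite scaleN1r.
  have lt0 : (a *m rho k) 0 (sigma i) < 0.
    rewrite -[a](subrK (e i)) mulmxDl mxE (kLT _ aL) ?inE ?eqxx // add0r.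
    rewrite lt_neqAle (coef_moved kLT) /= -oppr_ge0.
    by have := ki (sigma i); rewrite mxE.
  by have := pos (sigma i); rewrite leNgt lt0.
have akJ : in_span J (a *m rho k) by do 2!apply: (closed_span _ clJ); apply: in_span_simple.
have u1 : (u * (k * w0))%g = 1%g.
  apply: (faithful rep) => j; have [->|ji] := eqVneq j i; last by apply: u0; rewrite !inE.
  by rewrite !(actM rep); apply: nonneg_w0.
apply: span_image_eq => v vL; rewrite -[v](act1 rep) -u1 !(actM rep).
by apply/w0T/kLT/(parabolic_span rep).
Qed.

End Component.
End Opposition.

(** * A diagram automorphism cannot mix the identity and the opposition *)

Section Diagram.
Variables (R : archiRealFieldType) (W : groupType) (n : nat).
Variables (s : 'I_n -> W) (m : 'I_n -> 'I_n -> nat).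
Variables (G : 'M[R]_n) (rho : W -> 'M[R]_n).
Hypothesis rep : reflection_rep s m G rho.
Local Notation e := (simple R).
Local Notation B := (form G).
Implicit Types (i j : 'I_n) (P : {set 'I_n}).

Definition indicator P : 'rV[R]_n := \sum_(i in P) e i.

Lemma form_indicator P j : B (indicator P) (e j) = \sum_(i in P) G i j.
Proof. by rewrite form_suml; apply: eq_bigr => i _; rewrite form_simple. Qed.

Lemma form_indicator_edge P i j : i \in P -> j \notin P -> G i j != 0 ->
  B (indicator P) (e j) <= -1.
Proof.
move=> iP jP Gij; have off k : k \in P -> k != j by apply: contraTneq => ->.
rewrite form_indicator (bigD1 i) //= -[-1]addr0; apply: lerD.
  by apply: (G_edge rep) => //; apply: off.
by apply: sumr_le0 => k /andP[/off kj _]; apply: (G_off rep).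
Qed.

Lemma form_indicatorU1 P j : j \notin P ->
  B (indicator (j |: P)) (indicator (j |: P)) =
  B (indicator P) (indicator P) + 2 * B (indicator P) (e j) + 2.
Proof.
move=> jP; rewrite /indicator big_setU1 //= formDl !formDr (B_simple rep).
rewrite (B_sym rep (e j)); ring.
Qed.

Lemma indicator_ge0 P : nonneg (indicator P).
Proof.
move=> i; rewrite /indicator summxE sumr_ge0 // => j _.
exact: nonneg_simple.
Qed.

Variables (J : {set 'I_n}) (sigma opp : 'I_n -> 'I_n).
Hypotheses (irrJ : irreducible G J) (posJ : posdef G J).
Hypotheses (oppJ : forall i, i \in J -> opp i \in J).
Hypothesis sigma_inj : {in J &, injective sigma}.
Hypothesis oppK : forall i, i \in J -> opp (opp i) = i.
Hypothesis sigma_form : forall i j, i \in J -> j \in J -> G (sigma i) (sigma j) = G i j.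
Hypothesis opp_form : forall i j, i \in J -> j \in J -> G (opp i) (opp j) = G i j.
Hypothesis sigma_or : forall i, i \in J -> sigma i = i \/ sigma i = opp i.

Let fixed i := (sigma i == i) && (opp i != i).
Let swapped i := sigma i != i.

Let swappedE i : i \in J -> swapped i -> sigma i = opp i /\ opp i != i.
Proof.
move=> iJ; rewrite /swapped; case: (sigma_or iJ) => [->|si]; first by rewrite eqxx.
by rewrite -{1}si => ne; split; rewrite -?si.
Qed.

Let disjoint_orbits a y : a \in J -> y \in J -> fixed a -> swapped y ->
  [/\ a != y, a != opp y, opp a != y & opp a != opp y].
Proof.
move=> aJ yJ /andP[/eqP sa oa] sy; have [syo oy] := swappedE yJ sy.
have ay : a != y by apply: contraNneq sy => <-; apply/eqP.
have aoy : a != opp y.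
  apply/eqP=> aoy; case/eqP: ay; apply: sigma_inj => //.
  by rewrite sa syo.
split=> //.
  by apply: contraNneq aoy => <-; rewrite oppK.
by apply: contraNneq ay => /(congr1 opp); rewrite !oppK // => ->.
Qed.

Let no_isotropic v i : in_span J v -> 1 <= v 0 i -> 0 < B v v.
Proof.
move=> vJ vi; apply: posJ => //; apply/eqP=> v0.
by move: vi; rewrite v0 mxE leNgt ltr01.
Qed.

(** An edge would give a cycle of length four through both pairs, and the form is
    not positive on the sum of its simple roots. *)
Let no_square a y : a \in J -> y \in J -> fixed a -> swapped y -> G a y = 0.
Proof.
move=> aJ yJ fa sy; apply/eqP; apply: contraT => Gay.
have [ay aoy oay oaoy] := disjoint_orbits aJ yJ fa sy.
have [syo oy] := swappedE yJ sy; have /andP[/eqP sa oa] := fa.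
have le1 := G_edge rep ay Gay.
have E1 : G a (opp y) = G a y by rewrite -{1}sa -syo sigma_form.
have E2 : G (opp a) (opp y) = G a y by rewrite opp_form.
have E3 : G (opp a) y = G a y by rewrite -{1}(oppK yJ) opp_form ?oppJ.
have o1 : G (opp a) a <= 0 by apply: (G_off rep).
have o2 : G (opp y) y <= 0 by apply: (G_off rep).
pose u := e a + e (opp a) + e y + e (opp y).
have uJ : in_span J u.
  by rewrite /u; do ?apply: in_spanD; apply: in_span_simple; rewrite ?oppJ.
have ua : 1 <= u 0 a.
  rewrite !mxE !eqxx /= (eq_sym a (opp a)) (negbTE oa) (negbTE ay) (negbTE aoy) !mulr0n; lra.
have := no_isotropic uJ ua; rewrite /u !formDl !formDr !form_simple !(rep_diag rep).
rewrite E1 E2 E3 (G_sym rep a (opp a)) (G_sym rep y a) (G_sym rep (opp y) a).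
rewrite (G_sym rep y (opp a)) (G_sym rep (opp y) (opp a)) (G_sym rep y (opp y)).
rewrite E1 E2 E3; lra.
Qed.

(** The vertex [x] is joined to [a] through a connected set [P] of vertices that
    are their own opposites.  The bound on the indicator vector is what remains
    of connectedness: adding a neighbour to [P] contributes [2] for the vertex
    and at most [-2] for the edge. *)
Let linked x := exists P a, [/\ x \in P, P \subset J,
  forall p, p \in P -> opp p = p, a \in J /\ fixed a &
  B (indicator P) (indicator P) <= 2 /\ B (indicator P) (e a) <= -1].

(** An edge would give an extended diagram of type D on [P] and the pairs of [a]
    and [y], with the familiar isotropic vector [u]. *)
Let no_extended_D x y : linked x -> y \in J -> swapped y -> G x y = 0.
Proof.
case=> P [a [xP PJ Pfix [aJ fa] [PP Pa]]] yJ sy.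
apply/eqP; apply: contraT => Gxy.
have [ay aoy oay oaoy] := disjoint_orbits aJ yJ fa sy.
have [syo oy] := swappedE yJ sy; have /andP[/eqP sa oa] := fa.
have yP : y \notin P by apply: contraNN oy => /Pfix/eqP.
have Py := form_indicator_edge xP yP Gxy.
have Popp j : j \in J -> B (indicator P) (e (opp j)) = B (indicator P) (e j).
  move=> jJ; rewrite !form_indicator; apply: eq_bigr => p pP.
  by rewrite -{1}(Pfix p pP) opp_form // (subsetP PJ).
have Poa := Popp a aJ; have Poy := Popp y yJ.
have o1 : G (opp a) a <= 0 by apply: (G_off rep).
have o2 : G (opp y) y <= 0 by apply: (G_off rep).
have o3 := G_off rep ay; have o4 := G_off rep aoy.
have o5 := G_off rep oay; have o6 := G_off rep oaoy.
pose v := indicator P; pose u := 2 *: v + e a + e (opp a) + e y + e (opp y).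
have vJ : in_span J v.
  move=> k kJ; rewrite /v /indicator summxE big1 // => p pP.
  by rewrite simpleE; case: eqP => // pk; rewrite -pk (subsetP PJ) in kJ.
have uJ : in_span J u.
  rewrite /u; do ?apply: in_spanD; try by apply: in_span_simple; rewrite ?oppJ.
  exact: in_spanZ.
have ua : 1 <= u 0 a.
  have := indicator_ge0 P a; rewrite -/v => va.
  rewrite !mxE !eqxx /= (eq_sym a (opp a)) (negbTE oa) (negbTE ay) (negbTE aoy).
  rewrite !mulr0n; lra.
have := no_isotropic uJ ua.
rewrite /u !(formDl, formDr) !(formZl, formZr) !form_simple !(rep_diag rep).
rewrite (B_sym rep _ v) !(B_sym rep (e _) v).
rewrite (G_sym rep a (opp a)) (G_sym rep y a) (G_sym rep (opp y) a).
rewrite (G_sym rep y (opp a)) (G_sym rep (opp y) (opp a)) (G_sym rep y (opp y)).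
rewrite -/v in PP Pa Py Poa Poy; rewrite Poa Poy; lra.
Qed.

(** Start from a vertex that [sigma] fixes and opposition moves.  Along edges one
    meets only vertices of this kind and vertices linked to one of them, never
    a vertex moved by [sigma]; as [J] is connected, no vertex is moved. *)
Lemma id_or_opp :
  (forall i, i \in J -> sigma i = i) \/ (forall i, i \in J -> sigma i = opp i).
Proof.
apply: contrapT => /not_orP[/existsNP[b /not_implyP[bJ /eqP sb]]].
case/existsNP=> a /not_implyP[aJ /eqP sa].
have fa : fixed a.
  case: (sigma_or aJ) sa => [saa|->]; last by rewrite eqxx.
  by rewrite /fixed saa eqxx eq_sym.
pose X := [set x in J | fixed x || `[< linked x >]].
have /subsetP/(_ b bJ) : J \subset X.
  apply: irrJ.
  - by apply/subsetP=> x; rewrite inE => /andP[].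
  - by apply/set0Pn; exists a; rewrite inE aJ fa.
  move=> x y; rewrite !inE => /andP[xJ xX] yJ Gxy; rewrite yJ /=.
  have [sy|sy] := boolP (swapped y).
    case/eqP: Gxy; case/orP: xX => [fx|/asboolP lx]; first exact: no_square.
    exact: no_extended_D.
  have [//|nfy] := boolP (fixed y); apply/asboolP.
  have oy : opp y = y.
    by move: nfy; rewrite /fixed (negbNE sy) /= negbK => /eqP.
  have fx_y x' : fixed x' -> y != x'.
    by case/andP=> _ ox'; apply: contraNneq ox' => <-; apply/eqP.
  case/orP: xX => [fx|/asboolP[P [c [xP PJ Pfix [cJ fc] [PP Pc]]]]].
    exists [set y], x; split; rewrite ?inE ?sub1set //.
    - by move=> p; rewrite inE => /eqP->.
    - rewrite /indicator big_set1 (B_simple rep) form_simple; split=> //.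
      by rewrite (G_edge rep) ?fx_y // (G_sym rep).
  have [yP|yP] := boolP (y \in P); first by exists P, c; split.
  exists (y |: P), c; split=> //.
  - exact: setU11.
  - by rewrite subUset sub1set yJ.
  - by move=> p; rewrite !inE => /orP[/eqP->//|/Pfix].
  have Py := form_indicator_edge xP yP Gxy.
  split; first by rewrite form_indicatorU1 //; lra.
  rewrite /indicator big_setU1 //= formDl form_simple.
  have := G_off rep (fx_y c fc); move: Pc; rewrite /indicator; lra.
rewrite inE bJ /= => /orP[/andP[/eqP sbb _]|/asboolP[P [c [bP _ /(_ b bP) ob _ _]]]].
  by rewrite sbb eqxx in sb.
by case: (sigma_or bJ) => sbE; rewrite sbE ?ob eqxx in sb.
Qed.

End Diagram.

(** * A single conjugating element *)

Section Conjugator.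
Variables (R : archiRealFieldType) (W : groupType) (n : nat).
Variables (s : 'I_n -> W) (m : 'I_n -> 'I_n -> nat).
Variables (G : 'M[R]_n) (rho : W -> 'M[R]_n) (F : 'M[R]_n).
Hypotheses (rep : reflection_rep s m G rho) (autF : root_automorphism G rho F).
Local Notation e := (simple R).
Local Notation closed := (closed_under_edges G).
Implicit Types (i j : 'I_n) (v : 'rV[R]_n) (J : {set 'I_n}).

Lemma component_conjugator J : closed J -> irreducible G J -> simple_twist rho F J ->
  exists w, exists2 c : R, c ^+ 2 = 1 & forall i, i \in J -> e i *m F = c *: (e i *m rho w).
Proof.
move=> clJ irrJ [C tC [sigma sigmaP]].
have [c c2 [h CE]] := tC.
have FE v : v *m F = c *: (v *m C *m rho h^-1%g).
  rewrite CE -scalemxAr -scalemxAl scalerA -expr2 c2 scale1r mulmxA.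
  by rewrite (actK rep).
have [allid|] := pselect (forall i, i \in J -> sigma i = i).
  exists h^-1%g, c => // i iJ; have [_ iE] := sigmaP i iJ.
  by rewrite FE iE allid.
case/existsNP=> i0 /not_implyP[i0J /eqP si0].
have pJ := posdef_of_moved rep autF clJ irrJ tC sigmaP i0J si0.
have [w0 [opp [Jw0 oppP]]] := longest_element rep pJ.
have [] := @id_or_opp _ _ _ _ _ _ _ rep J sigma opp irrJ pJ.
- by move=> i /oppP[].
- move=> i j iJ jJ; apply: (sigma_inj rep autF tC sigmaP iJ jJ).
- by move=> i iJ; apply: (oppK rep clJ Jw0 oppP iJ).
- by move=> i j iJ jJ; apply: (sigma_form rep autF tC sigmaP iJ jJ).
- by move=> i j iJ jJ; apply: (opp_form rep oppP iJ jJ).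
- by move=> i iJ; apply: (sigma_id_or_opp rep autF clJ tC sigmaP Jw0 oppP iJ).
- by move/(_ i0 i0J)/eqP; rewrite (negbTE si0).
move=> allopp; exists (w0 * h^-1)%g, (- c); rewrite ?sqrrN // => i iJ.
have [_ iE] := sigmaP i iJ; have [_ iO] := oppP i iJ.
by rewrite FE iE allopp // (actM rep) iO mulNmx scalerN scaleNr opprK.
Qed.

(** The element [a] is the component of [w] in the direct factor of [W] generated
    by [J]. *)
Lemma component_factor J w : closed J -> exists a,
  (forall v, in_span J v -> v *m rho a = v *m rho w) /\
  (forall v, in_span (~: J) v -> v *m rho a = v).
Proof.
move=> clJ; elim/(word_ind rep): w => [|i w [a [aJ aC]]].
  by exists 1%g; split=> // v _; rewrite (act1 rep).
have [iJ|iJ] := boolP (i \in J).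
  have eJ := in_span_simple R iJ.
  exists (s i * a)%g; split=> v vJ; rewrite !(actM rep) !(rho_gen rep).
    by rewrite aJ //; apply/in_spanD/in_spanN/in_spanZ.
  by rewrite (B_sym rep) (closed_form0 rep clJ eJ vJ) scale0r subr0 aC.
exists a; split=> // v vJ; rewrite (actM rep) (rho_gen rep) aJ //.
have eJ : in_span (~: J) (e i) by apply: in_span_simple; rewrite inE.
by rewrite (closed_form0 rep clJ vJ eJ) scale0r subr0.
Qed.

Lemma global_conjugator : exists w, forall i,
  exists2 c : R, c ^+ 2 = 1 & e i *m F = c *: (e i *m rho w).
Proof.
pose P (T : {set 'I_n}) := `[< closed T /\ exists w, forall i, i \in T ->
  exists2 c : R, c ^+ 2 = 1 & e i *m F = c *: (e i *m rho w) >].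
have P0 : P set0 by apply/asboolP; split=> [i j|]; [|exists 1%g => i]; rewrite inE.
have [T /maxsetP[/asboolP[clT [w wT]] maxT] _] := maxset_exists P0.
exists w => i; apply: (wT i); apply: contraT => iT.
have [J iJ [irrJ clJ tJ]] := component_twist rep autF i.
have JT : J \subset ~: T.
  apply/subsetP=> j jJ; rewrite inE; apply: contra iT => jT.
  suff /subsetP/(_ i iJ) : J \subset J :&: T by rewrite inE => /andP[].
  apply: irrJ; first exact: subsetIl.
    by apply/set0Pn; exists j; rewrite inE jJ.
  move=> x y; rewrite !inE => /andP[xJ xT] yJ; rewrite yJ /=.
  by apply: contraR => yT; apply/eqP/clT.
have [g [c c2 gJ]] := component_conjugator clJ irrJ tJ.
have [a [aT aC]] := component_factor w clT.
have [b [bJ bC]] := component_factor g clJ.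
have TJ : T \subset ~: J by rewrite -[T]setCK setCS.
have : P (J :|: T).
  apply/asboolP; split.
    move=> x y; rewrite !inE negb_or => /orP[xJ|xT] /andP[yJ yT].
      exact: clJ.
    exact: clT.
  exists (a * b)%g => x; rewrite inE => /orP[xJ|xT].
    exists c => //; rewrite gJ // (actM rep) aC ?bJ //; first exact: in_span_simple.
    by apply: in_span_simple; apply: (subsetP JT).
  have [c' c'2 xE] := wT x xT; exists c' => //.
  have xTs := in_span_simple R xT.
  rewrite xE (actM rep) aT // bC //; apply: (in_spanS TJ).
  exact: (closed_span rep).
by move/maxT => /(_ (subsetUr _ _)) JTE; rewrite -JTE inE iJ in iT.
Qed.

End Conjugator.

(** * Products of matrix entries along closed walks, and traces *)

Section ClosedWalks.
Variables (R : realFieldType) (I : finType).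
Implicit Types (g : I -> I -> R) (i j : I) (p q : seq I).

Fixpoint walk_prod g i p : R :=
  if p is j :: p' then g i j * walk_prod g j p' else 1.

Lemma walk_prod_cat g i p j q :
  walk_prod g i (p ++ j :: q) = walk_prod g i (rcons p j) * walk_prod g j q.
Proof.
elim: p i => [|k p IHp] i /=; first by rewrite mulr1.
by rewrite IHp mulrA.
Qed.

Lemma walk_prod_rcons g i p j : walk_prod g i (rcons p j) = walk_prod g i p * g (last i p) j.
Proof.
elim: p i => [|k p IHp] i /=; first by rewrite mulrC.
by rewrite IHp mulrA.
Qed.

Lemma not_uniq_split (x0 : seq I) : ~~ uniq x0 ->
  exists x p q r, x0 = p ++ x :: q ++ x :: r.
Proof.
elim: x0 => //= x l IHl; rewrite negb_and negbK => /orP[xl|/IHl[y [p [q [r ->]]]]].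
  by have [q r] := splitPr xl; exists x, [::], q, r.
by exists y, (x :: p), q, r.
Qed.

Variables g g' : I -> I -> R.
Hypotheses (g_sym : forall i j, g i j = g j i).
Hypothesis cyclic_eq : forall i p, uniq (i :: p) ->
  walk_prod g' i (rcons p i) = walk_prod g i (rcons p i).

(** A closed walk that repeats a vertex splits there into two shorter ones. *)
Lemma closed_walk_eq i p : walk_prod g' i (rcons p i) = walk_prod g i (rcons p i).
Proof.
have [N] := ubnP (size p); elim: N i p => // N IHN i p; rewrite ltnS => pN.
have [|/not_uniq_split[x [[|k p1] [q [r /=]]]]] := boolP (uniq (i :: p)).
- exact: cyclic_eq.
- case=> -> pE; rewrite pE size_cat /= in pN.
  rewrite pE rcons_cat /= !walk_prod_cat !IHN //; lia.
case=> _ pE; rewrite pE size_cat /= size_cat /= in pN.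
have split h : walk_prod h i (rcons p i) =
  walk_prod h x (rcons q x) * walk_prod h i (rcons (p1 ++ x :: r) i).
  rewrite pE !rcons_cat /= rcons_cat /= !walk_prod_cat; ring.
by rewrite !split !IHN ?size_cat //=; lia.
Qed.

Lemma edge_sqr i j : g' i j * g' j i = g i j ^+ 2.
Proof. by have := closed_walk_eq i [:: j]; rewrite /= !mulr1 => ->; rewrite (g_sym j) expr2. Qed.

Hypothesis g'_sym : forall i j, g' i j = g' j i.

Lemma walk_prod_sqr i p : walk_prod g' i p ^+ 2 = walk_prod g i p ^+ 2.
Proof.
elim: p i => //= j p IHp i; rewrite !exprMn IHp; congr (_ * _).
by rewrite -edge_sqr (g'_sym j) expr2.
Qed.

Let edge i j := g i j != 0.

Lemma path_walk_neq0 i p : path edge i p -> walk_prod g i p != 0.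
Proof.
elim: p i => [|j p IHp] i /=; first by rewrite oner_eq0.
by case/andP=> ij /IHp; apply: mulf_neq0.
Qed.

(** The sign of a vertex is the ratio of the two products along a path to it from
    the root of its component; closed walks show that it does not depend on the
    path. *)
Lemma sign_potential : exists2 eps : I -> R,
  forall i, eps i ^+ 2 = 1 & forall i j, g' i j = eps i * eps j * g i j.
Proof.
have edge_sym : connect_sym edge.
  by apply: sym_connect_sym => i j; rewrite /edge g_sym.
have paths i : exists p, path edge (fingraph.root edge i) p /\ i = last (fingraph.root edge i) p.
  have : connect edge (fingraph.root edge i) i by rewrite edge_sym connect_root.
  by case/connectP=> p ? ?; exists p.
have [P PP] := choice paths.
pose a h i := walk_prod h (fingraph.root edge i) (P i).
have a0 i : a g i != 0 by apply: path_walk_neq0; case: (PP i).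
have aa i : a g' i ^+ 2 = a g i ^+ 2 by apply: walk_prod_sqr.
have a'0 i : a g' i != 0 by rewrite -sqrf_eq0 aa sqrf_eq0.
have eps2 i : (a g' i / a g i) ^+ 2 = 1 by rewrite expr_div_n aa divff // sqrf_eq0.
exists (fun i => a g' i / a g i) => // i j.
have [gij|gij] := eqVneq (g i j) 0.
  have /eqP := edge_sqr i j; rewrite gij expr0n (g'_sym j) -expr2 sqrf_eq0 => /eqP->.
  by rewrite mulr0.
have rij : fingraph.root edge i = fingraph.root edge j.
  by apply/eqP; rewrite (root_connect edge_sym) connect1.
have [q qp qE] : exists2 q, path edge j q & fingraph.root edge i = last j q.
  have : connect edge j (fingraph.root edge i) by rewrite rij connect_root.
  by case/connectP=> q; exists q.
have [p_path p_last] := PP i; have [p'_path p'_last] := PP j.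
have walk_cat h x p r : walk_prod h x (p ++ r) = walk_prod h x p * walk_prod h (last x p) r.
  by elim: p x => [|y p IHp] x /=; rewrite ?mul1r // IHp mulrA.
have walk_eq x p : last x p = x -> walk_prod g' x p = walk_prod g x p.
  by case/lastP: p => // p y; rewrite last_rcons => ->; apply: closed_walk_eq.
pose d h := walk_prod h j q.
have d0 : d g != 0 by apply: path_walk_neq0.
have d'0 : d g' != 0.
  by rewrite -sqrf_eq0 /d walk_prod_sqr sqrf_eq0.
have E1 : a g' i * g' i j * d g' = a g i * g i j * d g.
  have := walk_eq (fingraph.root edge i) (P i ++ j :: q).
  rewrite !walk_cat -p_last /= last_cat /= -qE => /(_ erefl).
  by rewrite !mulrA.
have E2 : a g' j * d g' = a g j * d g.
  have := walk_eq (fingraph.root edge j) (P j ++ q).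
  by rewrite !walk_cat last_cat -p'_last -qE rij => /(_ erefl).
have epsj : a g' j / a g j = d g / d g'.
  by apply/eqP; rewrite eqr_div // E2 mulrC.
have epsi : a g' i / a g i = (a g' i / a g i)^-1.
  by apply: (mulfI (x := a g' i / a g i)); rewrite ?divff -?expr2 ?eps2 // mulf_neq0 ?invr_neq0.
rewrite epsi epsj invf_div.
apply: (mulfI (a'0 i)); apply: (mulIf d'0); rewrite E1.
field; by rewrite a'0 d'0.
Qed.

End ClosedWalks.

Section Traces.
Variables (R : realFieldType) (n k : nat).
Implicit Types (M N : 'I_n -> 'M[R]_k) (u v : seq 'I_n).

Definition mx_prod M u : 'M[R]_k := foldr (fun i A => M i *m A) 1%:M u.

Lemma mx_prod_rcons M u i (A : 'M[R]_k) : mx_prod M (rcons u i) *m A = mx_prod M u *m (M i *m A).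
Proof. by elim: u => [|j u IHu] /=; rewrite ?mulmx1 ?mul1mx // -!mulmxA IHu. Qed.

(** Each factor [M i] is [1 - (1 - M i)], so the factors can be replaced by their
    complements one at a time. *)
Lemma trace_complement M N :
  (forall u, uniq u -> \tr (mx_prod (fun i => 1%:M - M i) u) =
                       \tr (mx_prod (fun i => 1%:M - N i) u)) ->
  forall u, uniq u -> \tr (mx_prod M u) = \tr (mx_prod N u).
Proof.
move=> trE; suff gen u v : uniq (u ++ v) ->
  \tr (mx_prod M u *m mx_prod (fun i => 1%:M - M i) v) =
  \tr (mx_prod N u *m mx_prod (fun i => 1%:M - N i) v).
  by move=> u uu; have := gen u [::]; rewrite cats0 /= !mulmx1 => ->.
elim/last_ind: u v => [|u i IHu] v uv; first by rewrite !mul1mx trE.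
have expand (P : 'I_n -> 'M[R]_k) :
  \tr (mx_prod P (rcons u i) *m mx_prod (fun i => 1%:M - P i) v) =
  \tr (mx_prod P u *m mx_prod (fun i => 1%:M - P i) v) -
  \tr (mx_prod P u *m mx_prod (fun i => 1%:M - P i) (i :: v)).
  rewrite mx_prod_rcons -raddfB /= -mulmxBr; congr (\tr (_ *m _)).
  by rewrite mulmxBl mul1mx opprB addrC subrK.
rewrite !expand !IHu -?cat_rcons //.
by move: uv; rewrite cat_rcons !cat_uniq /= => /and3P[-> /norP[_ ->] /andP[_ ->]].
Qed.

Lemma mx_prod_rank1 (b : 'I_n -> 'cV[R]_k) (c : 'I_n -> 'rV[R]_k) i p :
  mx_prod (fun i => b i *m c i) (i :: p) =
  walk_prod (fun i j => (c i *m b j) 0 0) i p *: (b i *m c (last i p)).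
Proof.
elim: p i => [|j p IHp] i; first by rewrite /= mulmx1 scale1r.
set P := fun i => _; rewrite -[LHS]/(P i *m mx_prod P (j :: p)) IHp /P.
rewrite -scalemxAr -mulmxA (mulmxA (c i)).
by rewrite [c i *m b j]mx11_scalar mul_scalar_mx -scalemxAr scalerA mulrC.
Qed.

Lemma trace_rank1 (b : 'I_n -> 'cV[R]_k) (c : 'I_n -> 'rV[R]_k) i p :
  \tr (mx_prod (fun i => b i *m c i) (i :: p)) =
  walk_prod (fun i j => (c i *m b j) 0 0) i (rcons p i).
Proof.
by rewrite mx_prod_rank1 mxtraceZ mxtrace_mulC [c _ *m _]mx11_scalar mxtrace_scalar walk_prod_rcons.
Qed.

End Traces.

(** * The root automorphism defined by a group automorphism *)

Section AutomorphismMatrix.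
Variables (R : archiRealFieldType) (W : groupType) (n : nat).
Variables (s : 'I_n -> W) (m : 'I_n -> 'I_n -> nat).
Variables (G : 'M[R]_n) (rho : W -> 'M[R]_n) (rho2 : W -> 'M[R]_(n + n)).
Hypothesis rep : reflection_rep s m G rho.
Local Notation e := (simple R).
Local Notation B := (form G).
Local Notation root := (root rho).
Implicit Types (i j : 'I_n) (v : 'rV[R]_n) (y : 'rV[R]_(n + n)) (w : W) (u : seq 'I_n).

(** The form [G] may be degenerate, so a second copy of the space is added, which
    pairs with the simple roots as their dual.  The generators act on the sum as
    reflections with linearly independent coroots. *)
Definition wide v : 'rV[R]_(n + n) := row_mx v 0.

Definition wide_coroot i : 'cV[R]_(n + n) := col_mx (col i G) (simple R i)^T.

Hypothesis rho2_1 : rho2 1%g = 1%:M.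
Hypothesis rho2M : forall w w', rho2 (w * w')%g = rho2 w *m rho2 w'.
Hypothesis rho2_gen : forall i, rho2 (s i) = 1%:M - wide_coroot i *m wide (e i).

Let a i y : R := (y *m wide_coroot i) 0 0.

Let act2_gen y i : y *m rho2 (s i) = y - a i y *: wide (e i).
Proof.
rewrite rho2_gen mulmxBr mulmx1 mulmxA.
by rewrite [y *m _]mx11_scalar mul_scalar_mx.
Qed.

Let act2M y w w' : y *m rho2 (w * w')%g = y *m rho2 w *m rho2 w'.
Proof. by rewrite rho2M mulmxA. Qed.

Let aD i y y' : a i (y + y') = a i y + a i y'.
Proof. by rewrite /a mulmxDl mxE. Qed.

Let aZ i c y : a i (c *: y) = c * a i y.
Proof. by rewrite /a -scalemxAl mxE. Qed.

Let a_wide i v : a i (wide v) = B v (e i).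
Proof. by rewrite /a mul_row_col mul0mx addr0 mul_col_form mxE eqxx. Qed.

Let act2_wide v w : wide v *m rho2 w = wide (v *m rho w).
Proof.
elim/(word_ind rep): w v => [|i w IHw] v; first by rewrite rho2_1 mulmx1 (act1 rep).
rewrite act2M act2_gen a_wide (actM rep) (rho_gen rep) -IHw; congr (_ *m _).
by rewrite /wide scale_row_mx scaler0 opp_row_mx add_row_mx oppr0 addr0.
Qed.

Let wideB v v' : wide (v - v') = wide v - wide v'.
Proof. by rewrite /wide opp_row_mx add_row_mx subr0. Qed.

Let wideD v v' : wide (v + v') = wide v + wide v'.
Proof. by rewrite /wide add_row_mx addr0. Qed.

Let wideZ c v : wide (c *: v) = c *: wide v.
Proof. by rewrite /wide scale_row_mx scaler0. Qed.

Let dual i : 'rV[R]_(n + n) := row_mx 0 (e i).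

Let a_dual i j : a j (dual i) = (i == j)%:R.
Proof. by rewrite /a mul_row_col mul0mx add0r trmx_delta -colE [LHS]mxE simpleE. Qed.

Let dual_fix i u : i \notin u -> dual i *m rho2 (gen_prod s u) = dual i.
Proof.
elim: u => [|j u IHu]; first by rewrite gen_prod_nil rho2_1 mulmx1.
rewrite inE negb_or => /andP[ij iu]; rewrite gen_prod_cons act2M act2_gen.
by rewrite a_dual (negbTE ij) scale0r subr0 IHu.
Qed.

(** A multiple of the vector dual to the first letter changes the coefficient of
    that letter and no other, because the later letters fix the dual vector. *)
Let coxeter_image u v : uniq u -> in_span [set i in u] v ->
  exists y, y - y *m rho2 (gen_prod s u) = wide v.
Proof.
elim: u v => [|i u IHu] v.
  move=> _ v0; exists 0; rewrite mul0mx subr0.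
  have -> : v = 0 by apply/rowP=> i; rewrite v0 ?inE // mxE.
  by rewrite /wide row_mx0.
move=> /= /andP[iu uu] vu.
have [|y yE] := IHu (v - v 0 i *: e i) uu.
  move=> j; rewrite inE => ju; rewrite !mxE eqxx /= eq_sym.
  have [->|ij] := eqVneq i j; first by rewrite mulr1 subrr.
  by rewrite mulr0 subr0 vu // !inE negb_or eq_sym ij.
pose z := y + (- v 0 i - a i y) *: dual i.
have zE : z - z *m rho2 (gen_prod s u) = wide (v - v 0 i *: e i).
  by rewrite /z mulmxDl -scalemxAl dual_fix // opprD addrACA subrr addr0.
have az : a i z = - v 0 i by rewrite /z aD aZ a_dual eqxx mulr1n mulr1 addrC subrK.
exists (z *m rho2 (s i)).
have zK : z *m rho2 (s i) *m rho2 (gen_prod s (i :: u)) = z *m rho2 (gen_prod s u).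
  by rewrite -act2M gen_prod_cons (gen_mulK (rep_rel rep) (rep_mdiag rep)).
rewrite zK act2_gen az scaleNr opprK addrAC zE wideB wideZ subrK //.
Qed.

Variables (alpha : W -> W) (beta : W -> W) (x : 'I_n -> W).
Hypothesis alphaM : forall w w', alpha (w * w')%g = (alpha w * alpha w')%g.
Hypothesis betaK : forall w, alpha (beta w) = w.
Hypothesis alpha_gen : forall i, alpha (s i) = (s i ^ x i)%g.
Hypothesis alpha_prod : forall u, uniq u ->
  exists g, alpha (gen_prod s u) = (gen_prod s u ^ g)%g.

Let alpha1 : alpha 1%g = 1%g.
Proof. by apply: (mulgI (alpha 1%g)); rewrite -alphaM !mulg1. Qed.

Let b i : 'rV[R]_n := e i *m rho (x i).

Let rho_alpha_gen i : rho (alpha (s i)) = 1%:M - (G *m (b i)^T) *m b i.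
Proof.
apply/row_matrixP => k; rewrite !rowE -/(simple R k) alpha_gen (reflection_act rep) -/(b i).
rewrite mulmxBr mulmx1 !(mulmxA (simple R k)); congr (_ - _).
by rewrite [X in _ = X *m _]mx11_scalar mul_scalar_mx.
Qed.

Let rho_prod u : rho (gen_prod s u) = mx_prod (fun i => 1%:M - col i G *m e i) u.
Proof.
elim: u => [|i u IHu]; first by rewrite gen_prod_nil (rep1 rep).
by rewrite gen_prod_cons (repM rep) IHu (rep_gen rep).
Qed.

Let rho_alpha_prod u :
  rho (alpha (gen_prod s u)) = mx_prod (fun i => 1%:M - (G *m (b i)^T) *m b i) u.
Proof.
elim: u => [|i u IHu]; first by rewrite gen_prod_nil alpha1 (rep1 rep).
by rewrite gen_prod_cons alphaM (repM rep) IHu rho_alpha_gen.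
Qed.

Let trace_conj w w' : \tr (rho (w ^ w')%g) = \tr (rho w).
Proof.
rewrite conjgE (repM rep) mxtrace_mulC -(repM rep).
by rewrite -!mulgA mulgV mulg1.
Qed.

(** Products of distinct generators have the same trace as their images, and the
    trace of a product of rank one matrices is a cyclic product of Gram
    entries. *)
Lemma gram_signs : exists2 eps : 'I_n -> R,
  forall i, eps i ^+ 2 = 1 & forall i j, B (b i) (b j) = eps i * eps j * G i j.
Proof.
apply: sign_potential => [i j|i p ip|i j]; [exact: (G_sym rep) | | exact: (B_sym rep)].
have trE u : uniq u ->
    \tr (mx_prod (fun i => (G *m (b i)^T) *m b i) u) = \tr (mx_prod (fun i => col i G *m e i) u).
  apply: trace_complement => {}u uu; rewrite -rho_prod -rho_alpha_prod.
  by have [g ->] := alpha_prod uu; apply: trace_conj.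
have := trE _ ip; rewrite !trace_rank1 => trEip.
have wE (h h' : 'I_n -> 'I_n -> R) q k : (forall i j, h i j = h' i j) ->
    walk_prod h k q = walk_prod h' k q.
  by move=> hh'; elim: q k => //= l q IHq k; rewrite hh' IHq.
transitivity (walk_prod (fun i j => (b i *m (G *m (b j)^T)) 0 0) i (rcons p i)).
  by apply: wE => k l; rewrite mulmxA.
rewrite trEip; apply: wE => k l.
by rewrite mul_col_form form_simple mxE eqxx.
Qed.

(** The rows of [F] are the roots [b i] with the signs of [gram_signs].  For a set
    [J] with product [c] and [alpha c] conjugate to [c] by [g], the span of [J] is
    the image of [1 - c] on the larger space, so its image under [g] is that of
    [1 - alpha c], which lies in the image of the span of [J] under [F]. *)
Lemma root_automorphism_of_conj : exists2 F : 'M[R]_n,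
  root_automorphism G rho F &
  forall i, exists2 c : R, c ^+ 2 = 1 & e i *m F = c *: (e i *m rho (x i)).
Proof.
have [eps eps2 epsE] := gram_signs.
pose F : 'M[R]_n := \matrix_i (eps i *: b i).
have FE i : e i *m F = eps i *: b i by rewrite -rowE rowK.
exists F; last by move=> i; exists (eps i).
have FB v v' : B (v *m F) (v' *m F) = B v v'.
  rewrite (mul_simple_sum F (@in_spanT _ _ v)) (mul_simple_sum F (@in_spanT _ _ v')).
  rewrite [in RHS](in_span_sum (@in_spanT _ _ v)) [in RHS](in_span_sum (@in_spanT _ _ v')).
  rewrite !form_suml; apply: eq_bigr => i _; rewrite !form_sumr; apply: eq_bigr => j _.
  rewrite !formZl !formZr !FE formZl formZr epsE form_simple; congr (_ * (_ * _)).
  transitivity (eps i ^+ 2 * eps j ^+ 2 * G i j); last by rewrite !eps2 !mul1r.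
  ring.
have bF i : b i = eps i *: (e i *m F) by rewrite FE scalerA -expr2 eps2 scale1r.
have FA v w : v *m rho w *m F = v *m F *m rho (alpha w).
  elim/(word_ind rep): w v => [|i w IHw] v; first by rewrite alpha1 !(act1 rep).
  rewrite alphaM !(actM rep) IHw; congr (_ *m _).
  rewrite (rho_gen rep) alpha_gen (reflection_act rep) -/(b i) mulmxBl -scalemxAl bF.
  by rewrite formZr FB scalerA mulrAC -expr2 eps2 mul1r.
have root_eps i v : root v -> root (eps i *: v) by apply: (root_sign_scale rep).
have rootF v : root v -> root (v *m F).
  case=> i [w ->]; rewrite FA FE -scalemxAl; apply/root_eps/(root_act rep).
  by exists i, (x i).
have preF v : root v -> exists2 v', root v' & v' *m F = v.
  case=> i [w ->]; exists (eps i *: (e i *m rho (beta ((x i)^-1 * w)%g))).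
    by apply: root_eps; exists i, (beta ((x i)^-1 * w)%g).
  rewrite -scalemxAl FA betaK FE -scalemxAl scalerA -expr2 eps2 scale1r /b.
  by rewrite (actM rep) (actK rep).
have uF : F \in unitmx.
  have pre i : exists v, v *m F = e i.
    by have [v _ vF] := preF (e i) (root_simple rep i); exists v.
  have [D DE] := choice pre.
  have : (\matrix_i D i) *m F = 1%:M.
    by apply/row_matrixP=> i; rewrite row_mul rowK DE row1.
  by case/mulmx1_unit.
split=> // [v|J].
  by case/preF=> v' rv' <-; rewrite mulmxK.
have alpha_image u y : exists2 z, in_span [set i in u] z &
    y - y *m rho2 (alpha (gen_prod s u)) = wide (z *m F).
  elim: u y => [|i u IHu] y.
    exists 0; first exact: in_span0.
    by rewrite gen_prod_nil alpha1 rho2_1 mulmx1 subrr mul0mx /wide row_mx0.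
  have [c cE] : exists c, y *m rho2 (alpha (s i)) = y - c *: wide (e i *m F).
    rewrite alpha_gen conjgE !act2M act2_gen mulmxBl -mulmxA -rho2M mulVg rho2_1 mulmx1.
    rewrite -scalemxAl act2_wide -/(b i) bF wideZ scalerA.
    by eexists.
  have [z zu zE] := IHu (y *m rho2 (alpha (s i))).
  exists (c *: e i + z).
    apply: in_spanD; first by apply/in_spanZ/in_span_simple; rewrite !inE eqxx.
    by apply: in_spanS zu; apply/subsetP=> j; rewrite !inE => ->; rewrite orbT.
  rewrite gen_prod_cons alphaM act2M mulmxDl wideD -zE -scalemxAl wideZ.
  by rewrite cE addrA [_ + (y - _)]addrC subrK.
have [g gE] := alpha_prod (enum_uniq (mem J)).
have JE : [set i in enum (mem J)] = J by apply/setP=> i; rewrite inE mem_enum.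
exists g^-1%g => v vJ.
have uA : F *m rho g^-1%g \in unitmx by rewrite unitmx_mul uF (rho_unit rep).
have inv_span z : in_span J z -> in_span J (z *m invmx (F *m rho g^-1%g)).
  move=> zJ; have [|y yE] := @coxeter_image (enum (mem J)) z (enum_uniq _).
    by rewrite JE.
  have [z' z'J z'E] := alpha_image (enum (mem J)) (y *m rho2 g).
  rewrite JE in z'J.
  suff -> : z *m invmx (F *m rho g^-1%g) = z' by [].
  apply: (can_inj (mulmxK uA)); rewrite mulmxKV //.
  suff zg : z *m rho g = z' *m F by rewrite mulmxA -zg (actK rep).
  have : wide (z *m rho g) = wide (z' *m F).
    rewrite -z'E gE conjgE !act2M -(mulmxA y) -rho2M mulgV rho2_1 mulmx1.
    by rewrite -mulmxBl yE act2_wide.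
  by case/eq_row_mx.
have uiA : invmx (F *m rho g^-1%g) \in unitmx by rewrite unitmx_inv.
by have := in_span_invmx uiA (erefl #|J|) inv_span vJ; rewrite invmxK mulmxA.
Qed.

End AutomorphismMatrix.

(** * Trigonometry of the geometric representation *)

Section DihedralRelation.
Variables (R : realType) (E : lmodType R).

Definition reflect (a : E -> R) (e v : E) := v - a v *: e.

Lemma sin_angle_gt0 k : (1 < k)%N -> 0 < sin (pi / k%:R : R).
Proof.
move=> k1; apply: sin_gt0_pi; rewrite divr_gt0 ?pi_gt0 ?ltr0n ?(ltnW k1) //=.
by rewrite ltr_pdivrMr ?ltr0n ?(ltnW k1) // ltr_pMr ?pi_gt0 // ltr1n.
Qed.

Lemma sin_step (theta t : R) :
  2 * cos theta * sin (t + theta) - sin t = sin (t + theta + theta).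
Proof.
have -> : sin t = sin (t + theta - theta) by rewrite addrK.
rewrite sinB (sinD (t + theta)); ring.
Qed.

Variables (a1 a2 : E -> R) (e1 e2 : E) (k : nat).
Let theta : R := pi / k%:R.
Let c : R := 2 * cos theta.

Hypotheses (k_gt1 : (1 < k)%N).
Hypotheses (a1_lin : forall x u v, a1 (x *: u + v) = x * a1 u + a1 v).
Hypotheses (a2_lin : forall x u v, a2 (x *: u + v) = x * a2 u + a2 v).
Hypotheses (a11 : a1 e1 = 2) (a22 : a2 e2 = 2) (a12 : a1 e2 = - c) (a21 : a2 e1 = - c).

Let comb v (p q : R) := p *: e1 + (q *: e2 + v).

Let reflect1 v p q : reflect a1 e1 (comb v p q) = comb v (c * q - p - a1 v) q.
Proof.
rewrite /reflect /comb !a1_lin a11 a12 addrAC -scalerBl; congr (_ *: _ + _); ring.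
Qed.

Let reflect2 v p q : reflect a2 e2 (comb v p q) = comb v p (c * p - q - a2 v).
Proof.
rewrite /reflect /comb !a2_lin a22 a21 -addrA addrAC -scalerBl.
congr (_ + (_ *: _ + _)); ring.
Qed.

(** The product of the two reflections preserves the affine plane through [v]
    spanned by [e1] and [e2].  There it is a rotation by twice the angle about
    the point with coordinates [(- x, - y)], and [p], [q] are the coordinates of
    the orbit of [v]. *)
Lemma dihedral_relation v :
  iter k (fun u => reflect a2 e2 (reflect a1 e1 u)) v = v.
Proof.
have s0 : sin theta != 0 by rewrite gt_eqF // sin_angle_gt0.
have d0 : 4 - c ^+ 2 != 0.
  rewrite /c exprMn cos2sin2 (_ : _ - _ = 4 * sin theta ^+ 2); last by ring.
  by rewrite mulf_neq0 ?pnatr_eq0 // sqrf_eq0.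
pose x := (2 * a1 v + c * a2 v) / (4 - c ^+ 2).
pose y := (c * a1 v + 2 * a2 v) / (4 - c ^+ 2).
have xE : a1 v = 2 * x - c * y by rewrite /x /y; field.
have yE : a2 v = 2 * y - c * x by rewrite /x /y; field.
pose p (t : R) := (y * sin t - x * sin (t - theta)) / sin theta - x.
pose q (t : R) := (y * sin (t + theta) - x * sin t) / sin theta - y.
have pS t : c * q t - p t - a1 v = p (t + theta + theta).
  rewrite /p /q xE addrK -sin_step.
  have := sin_step theta (t - theta); rewrite subrK => <-.
  rewrite -/c; field; exact: s0.
have qS t : c * p (t + theta + theta) - q t - a2 v = q (t + theta + theta).
  rewrite /p /q yE addrK -(sin_step theta (t + theta)) -/c.
  by rewrite -[in X in _ = X](sin_step theta t) -/c -sin_step -/c; field; exact: s0.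
have iterE j : iter j (fun u => reflect a2 e2 (reflect a1 e1 u)) v =
    comb v (p (theta *+ j.*2)) (q (theta *+ j.*2)).
  elim: j => [|j IHj].
    rewrite /= /p /q mulr0n sub0r add0r sin0 sinN !mulr0 sub0r subr0 mulrN opprK.
    rewrite !mulfK // !subrr /comb !scale0r !add0r //.
  by rewrite iterS IHj reflect1 pS reflect2 qS doubleS !(mulrSr theta).
have turn : theta *+ k.*2 = pi *+ 2.
  rewrite -muln2 mulrnA -[theta *+ k]mulr_natr divfK // pnatr_eq0 -lt0n.
  exact: ltnW.
rewrite iterE turn /p /q [pi *+ 2 - _]addrC [pi *+ 2 + _]addrC !sinD2pi.
rewrite sin2pi sinN !mulr0 sub0r subr0 mulrN opprK !mulfK // !subrr.
by rewrite /comb !scale0r !add0r.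
Qed.

End DihedralRelation.

Section GramMatrix.
Variable R : realType.

(** As the inverse of [0] is [0], an infinite entry, encoded by [0], gets the
    value [-2]. *)
Definition coxeter_entry (k : nat) : R := - (2 * cos (pi / k%:R)).

Lemma chebyshev_sin (t : R) k : chebyshev (2 * cos t) k * sin t = sin (t *+ k).
Proof.
have [N] := ubnP k; elim: N k => // N IHN [|[|k]] kN.
- by rewrite /= mul0r mulr0n sin0.
- by rewrite /= mul1r mulr1n.
rewrite [chebyshev _ _]/= -/(chebyshev _ k.+1) mulrBl -mulrA !IHN; try lia.
by rewrite !(mulrSr t) sin_step.
Qed.

Lemma chebyshev2 k : chebyshev (2 : R) k = k%:R.
Proof.
have [N] := ubnP k; elim: N k => // N IHN [|[|k]] kN //.
rewrite [chebyshev _ _]/= -/(chebyshev _ k.+1) !IHN; try lia.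
by rewrite -!natr1; ring.
Qed.

Lemma coxeter_entry0 : coxeter_entry 0 = -2.
Proof. by rewrite /coxeter_entry invr0 mulr0 cos0 mulr1. Qed.

Lemma coxeter_entry1 : coxeter_entry 1 = 2.
Proof. by rewrite /coxeter_entry divr1 cospi mulrN1 opprK. Qed.

Lemma coxeter_entry_ge k : -2 <= coxeter_entry k.
Proof. by rewrite /coxeter_entry; have := cos_le1 (pi / k%:R : R); lra. Qed.

Lemma coxeter_entry_cheb k l : k != 1%N -> k = 0%N \/ (l <= k)%N ->
  0 <= chebyshev (- coxeter_entry k) l.
Proof.
have [->|k0] := posnP k; first by rewrite coxeter_entry0 opprK chebyshev2 ler0n.
move=> k1 [k00|lk]; first by rewrite k00 in k0.
have k_gt1 : (1 < k)%N by lia.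
rewrite /coxeter_entry opprK -(pmulr_lge0 _ (sin_angle_gt0 R k_gt1)).
rewrite chebyshev_sin; apply: sin_ge0_pi; apply/andP; split.
  by rewrite mulrn_wge0 // divr_ge0 ?pi_ge0 ?ler0n.
rewrite -(mulr_natr (pi / k%:R)) -mulrA ger_pMr ?pi_gt0 // mulrC ler_pdivrMr ?ltr0n //.
by rewrite mul1r ler_nat.
Qed.

Lemma coxeter_entry_off k : k != 1%N -> coxeter_entry k = 0 \/ coxeter_entry k <= -1.
Proof.
move=> k1; have [->|k0] := posnP k; first by right; rewrite coxeter_entry0; lra.
have [->|k2] := eqVneq k 2; first by left; rewrite /coxeter_entry cos_pihalf mulr0 oppr0.
have k3 : (2 < k)%N by lia.
right; have c_gt0 : 0 < - coxeter_entry k.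
  rewrite /coxeter_entry opprK mulr_gt0 // cos_gt0_pihalf //.
  have angle0 : 0 < pi / k%:R :> R by rewrite divr_gt0 ?pi_gt0 ?ltr0n.
  rewrite (lt_trans _ angle0) ?oppr_lt0 ?divr_gt0 ?pi_gt0 //=.
  by rewrite ltr_pM2l ?pi_gt0 // ltf_pV2 ?posrE ?ltr0n // ltr_nat.
have := coxeter_entry_cheb k1 (or_intror k3); rewrite /= mulr1 subr0.
move: (coxeter_entry k) c_gt0 => x; nra.
Qed.

End GramMatrix.

(** * Representations from the presentation *)

Section Presentation.
Variables (W : groupType) (I : Type) (gen : I -> W) (m : I -> I -> nat).
Hypotheses (m_cox : coxeter_matrix m) (gen_pres : presented_by gen (coxeter_relators m)).

Lemma word_val_nil : word_val gen [::] = 1%g.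
Proof. exact: big_nil. Qed.

Lemma word_val_cons l u :
  word_val gen (l :: u) = ((if l.2 then (gen l.1)^-1 else gen l.1) * word_val gen u)%g.
Proof. exact: big_cons. Qed.

Lemma word_val_cat u v : word_val gen (u ++ v) = (word_val gen u * word_val gen v)%g.
Proof. exact: big_cat. Qed.

Lemma word_val_relator s t k :
  word_val gen (flatten (nseq k [:: (s, false); (t, false)])) = ((gen s * gen t) ^+ k)%g.
Proof.
elim: k => [|k IHk]; first by rewrite word_val_nil.
by rewrite /= !word_val_cons IHk expgS mulgA.
Qed.

Lemma coxeter_relation s t : ((gen s * gen t) ^+ m s t = 1)%g.
Proof.
rewrite -word_val_relator -[RHS]word_val_nil; apply/(proj2 gen_pres).
have rel : coxeter_relators m (flatten (nseq (m s t) [:: (s, false); (t, false)])).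
  by exists s, t.
by have := word_equiv_relator [::] [::] rel; rewrite /= cats0.
Qed.

Lemma coxeter_involution s : (gen s * gen s = 1)%g.
Proof. by have := coxeter_relation s s; rewrite (proj2 (proj2 m_cox s s) erefl) expg1. Qed.

Lemma coxeter_generator_inv s : ((gen s)^-1 = gen s)%g.
Proof. by apply: (mulgI (gen s)); rewrite coxeter_involution mulgV. Qed.

Lemma coxeter_ind (P : W -> Prop) :
  P 1%g -> (forall s w, P w -> P (gen s * w)%g) -> forall w, P w.
Proof.
move=> P1 PM w; have [u <-] := proj1 gen_pres w.
elim: u => [|[s b] u IHu]; first by rewrite word_val_nil.
rewrite word_val_cons /=; case: b; rewrite ?coxeter_generator_inv; exact: PM.
Qed.

(** Arbitrary transformations are allowed, because matrices and functions on a
    possibly infinite set are both needed. *)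
Lemma presentation_action (X : Type) (f : I -> X -> X) :
  (forall s t x, iter (m s t) (fun y => f t (f s y)) x = x) ->
  exists act : X -> W -> X,
    [/\ forall x, act x 1%g = x,
        forall x v w, act x (v * w)%g = act (act x v) w &
        forall x s, act x (gen s) = f s x].
Proof.
move=> rel; have fK s x : f s (f s x) = x.
  by have := rel s s x; rewrite (proj2 (proj2 m_cox s s) erefl).
pose actw (x : X) (u : word I) := foldl (fun y l => f l.1 y) x u.
have actw_cat x u v : actw x (u ++ v) = actw (actw x u) v by apply: foldl_cat.
have actw_relator s t k x :
    actw x (flatten (nseq k [:: (s, false); (t, false)])) = iter k (fun y => f t (f s y)) x.
  by elim: k x => // k IHk x; rewrite iterSr -IHk.
have actw_equiv u v : word_equiv (coxeter_relators m) u v -> forall x, actw x u = actw x v.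
  elim=> {u v} [|u v _ IH x|u v w _ IH _ IH' x|u v i b x|u v r [s [t ->]] x] //.
  - by rewrite IH.
  - by rewrite !actw_cat /= fK.
  - by rewrite !actw_cat actw_relator rel.
have [wd wdE] := choice (proj1 gen_pres).
have actE x u : actw x (wd (word_val gen u)) = actw x u.
  by apply: actw_equiv; apply/(proj2 gen_pres); rewrite wdE.
exists (fun x w => actw x (wd w)); split=> [x|x v w|x s].
- by rewrite -word_val_nil actE.
- by rewrite -{1}[v]wdE -{1}[w]wdE -word_val_cat actE actw_cat.
- have -> : gen s = word_val gen [:: (s, false)] by rewrite word_val_cons word_val_nil mulg1.
  by rewrite actE.
Qed.

Lemma presentation_mx_rep (R : realType) (N : nat) (M : I -> 'M[R]_N) :
  (forall s t (v : 'rV_N), iter (m s t) (fun y => y *m M s *m M t) v = v) ->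
  exists rho : W -> 'M[R]_N,
    [/\ rho 1%g = 1%:M, forall v w, rho (v * w)%g = rho v *m rho w &
        forall s, rho (gen s) = M s].
Proof.
move=> rel; have relM s t (A : 'M_N) : iter (m s t) (fun B => B *m M s *m M t) A = A.
  apply/row_matrixP => i; rewrite -[RHS](rel s t); elim: (m s t) => //= k IHk.
  by rewrite !row_mul IHk.
have [act [act1 actM act_gen]] :=
  presentation_action (f := fun s A => A *m M s) relM.
have actE w A : act A w = A *m act 1%:M w.
  elim/coxeter_ind: w A => [|s w IHw] A; first by rewrite !act1 mulmx1.
  by rewrite !actM !act_gen IHw [in RHS]IHw mul1mx mulmxA.
exists (act 1%:M); split=> [|v w|s]; first exact: act1.
  by rewrite actM actE.
by rewrite act_gen mul1mx.
Qed.

Variable R : realType.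
Local Notation g s t := (coxeter_entry R (m s t)).

Lemma coxeter_dihedral (E : lmodType R) (a : I -> E -> R) (e : I -> E) :
  (forall s x u v, a s (x *: u + v) = x * a s u + a s v) ->
  (forall s t, a s (e t) = g s t) ->
  forall s t v, iter (m s t) (fun u => reflect (a t) (e t) (reflect (a s) (e s) u)) v = v.
Proof.
move=> a_lin ae s t v; have [m_sym m1] := m_cox.
have diag r : g r r = 2 by rewrite (proj2 (m1 r r) erefl) coxeter_entry1.
have [->//|m0] := posnP (m s t).
have [mst1|mst1] := eqVneq (m s t) 1%N.
  rewrite mst1 /= -((proj1 (m1 s t)) mst1) /reflect.
  have -> : a s (v - a s v *: e s) = - a s v.
    by rewrite addrC -scaleNr a_lin ae diag; ring.
  by rewrite scaleNr opprK subrK.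
apply: dihedral_relation => //; first by lia.
- by rewrite ae diag.
- by rewrite ae diag.
- by rewrite m_sym; exact: ae.
Qed.

(** The contragredient representation lives on all functions on the generators,
    so it exists before the generating set is known to be finite. *)
Lemma contragredient_action : exists act : (I -> R) -> W -> (I -> R),
  [/\ forall f, act f 1%g = f,
      forall f v w, act f (v * w)%g = act (act f v) w &
      forall f s r, act f (gen s) r = f r - f s * g s r].
Proof.
pose F := I -> R^o.
pose a (s : I) (f : F) : R := f s.
pose e (s : I) : F := fun r => g s r.
have [|act [act1 actM act_gen]] := @presentation_action F (fun s => reflect (a s) (e s)).
  apply: coxeter_dihedral => // s t.
  by rewrite /a /e; case: m_cox => ->.
by exists act; split=> // f s r; rewrite act_gen.
Qed.

End Presentation.

(** Finitely many words for the elements of a finite generating family involve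
    finitely many letters.  Any other generator would be moved by no letter: in
    the contragredient representation these letters fix its indicator
    function, while the generator itself does not. *)
Lemma coxeter_generators_finite (W : groupType) (S : set W) :
  finitely_generated W -> coxeter_generating_set S ->
  exists2 l : seq W, uniq l & forall w, (w \in l) <-> S w.
Proof.
case=> n [h h_gen] [m [m_cox pres]].
have [word_of wordE] := choice (fun i => proj1 pres (h i)).
pose l := flatten [seq [seq val x.1 | x <- word_of i] | i : 'I_n].
have [act [act1 actM act_gen]] := contragredient_action m_cox pres Rdefinitions.R.
have Sl (s : S) : val s \in l.
  apply: contraT => sl; pose f (r : S) : Rdefinitions.R := (val r == val s)%:R.
  pose fixes w := act f w = f.
  have fixesM v w : fixes v -> fixes w -> fixes (v * w)%g.
    by rewrite /fixes actM => -> ->.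
  have fixesV v : fixes v -> fixes v^-1%g.
    by move=> vf; rewrite /fixes -{1}vf -actM mulgV act1.
  have fix1 : fixes 1%g by apply: act1.
  have fix_gen (t : S) : val t \in l -> fixes (val t).
    move=> tl; apply/funext => r; rewrite act_gen.
    have -> : f t = 0 by rewrite /f; case: eqP => // ts; rewrite -ts tl in sl.
    by rewrite mul0r subr0.
  have fix_h i : fixes (h i).
    have : {subset [seq val x.1 | x <- word_of i] <= l}.
      move=> x xi; apply/flattenP; exists [seq val x.1 | x <- word_of i] => //.
      by apply/mapP; exists i; rewrite ?mem_enum.
    rewrite -wordE; elim: (word_of i) => [|[t b] u IHu] sub; first by rewrite word_val_nil.
    rewrite word_val_cons; apply: fixesM; last first.
      by apply: IHu => x xu; apply: sub; rewrite inE xu orbT.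
    have ft : fixes (val t) by apply: fix_gen; apply: sub; rewrite inE eqxx.
    by case: b {sub} => //=; apply: fixesV.
  have fix_all w : fixes w.
    have [u <-] := h_gen w; elim: u => [|[i b] u IHu]; first by rewrite word_val_nil.
    rewrite word_val_cons; apply: fixesM => //; case: b => /=; last exact: fix_h.
    exact/fixesV/fix_h.
  have := congr1 (fun f' => f' s) (fix_all (val s)).
  rewrite act_gen /f eqxx (proj2 (proj2 m_cox s s) erefl) coxeter_entry1 mulr1n; lra.
exists (undup [seq x <- l | `[< S x >]]); first exact: undup_uniq.
move=> w; rewrite mem_undup mem_filter; split=> [/andP[/asboolP]//|Sw].
have wS : w \in S by apply: mem_set.
by rewrite (Sl (SigSub wS)) andbT; apply/asboolP.
Qed.

Local Open Scope group_scope.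

Theorem corollary1p5 (W : groupType) (S : set W)
    (W_fg : finitely_generated W)
    (S_cox : coxeter_generating_set S)
    (alpha : {multiplicative W -> W}) (alpha_aut : bijective alpha)
    (alpha_conj : forall s : seq W, uniq s -> (forall x, x \in s -> S x) ->
       conjugate (alpha (\prod_(x <- s) x)) (\prod_(x <- s) x)) :
  inner alpha.
Proof.
have [l l_uniq lS] := coxeter_generators_finite W_fg S_cox.
have [m [m_cox pres]] := S_cox.
pose n := size l; pose R := Rdefinitions.R : realType.
have exS (i : 'I_n) : exists t : S, val t = nth 1 l i.
  have /lS/mem_set wS : nth 1 l i \in l by apply: mem_nth.
  by exists (SigSub wS).
have [sS sSE] := choice exS.
have exI (t : S) : exists i : 'I_n, val t = nth 1 l i.
  have tl : val t \in l by apply/lS/set_mem/valP.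
  have ti : (index (val t) l < n)%N by rewrite index_mem.
  by exists (Ordinal ti); rewrite /= nth_index.
have [idx idxE] := choice exI.
have idxK i : idx (sS i) = i.
  apply/val_inj/eqP; rewrite -(nth_uniq 1 _ _ l_uniq) //; try exact: ltn_ord.
  by rewrite -idxE sSE.
have sSK t : sS (idx t) = t by apply: val_inj; rewrite sSE idxE.
pose s i : W := val (sS i).
pose mI i j := m (sS i) (sS j).
pose G : 'M[R]_n := (\matrix_(i, j) coxeter_entry R (mI i j))%R.
have [m_sym m1] := m_cox.
have s_inj : injective s by move=> i j /val_inj ij; rewrite -(idxK i) ij idxK.
have Gsym : (G^T = G)%R by apply/matrixP=> i j; rewrite !mxE /mI m_sym.
have mx_rep (N : nat) (e : 'I_n -> 'rV[R]_N) (a : 'I_n -> 'cV[R]_N) :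
    (forall i j, (e i *m a j) ord0 ord0 = G i j)%R ->
    exists rho : W -> 'M[R]_N, [/\ rho 1 = (1%:M)%R,
      forall v w, rho (v * w) = (rho v *m rho w)%R &
      forall i, rho (s i) = (1%:M - a i *m e i)%R].
  move=> eaG.
  have reflE i (v : 'rV[R]_N) :
      (v *m (1%:M - a i *m e i) = reflect (fun v => (v *m a i) ord0 ord0) (e i) v)%R.
    by rewrite mulmxBr mulmx1 mulmxA [(v *m a i)%R]mx11_scalar mul_scalar_mx.
  have [|rho [rho1 rhoM rho_gen]] := presentation_mx_rep m_cox pres
      (M := fun t => (1%:M - a (idx t) *m e (idx t))%R).
    move=> t t' v; pose ev (r : S) (u : 'rV[R]_N) : R := (u *m a (idx r))%R ord0 ord0.
    have ev_lin r x u u' : (ev r (x *: u + u') = x * ev r u + ev r u')%R.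
      by rewrite /ev mulmxDl -scalemxAl !mxE.
    have ev_e r r' : ev r (e (idx r')) = coxeter_entry R (m r r').
      by rewrite /ev eaG mxE /mI !sSK m_sym.
    rewrite -[RHS](coxeter_dihedral m_cox ev_lin ev_e t t' v).
    by apply: eq_iter => u; rewrite !reflE.
  by exists rho; split=> // i; rewrite rho_gen idxK.
have [|rho [rho1 rhoM rho_gen]] := mx_rep n (fun i => simple R i) (fun i => col i G)%R.
  by move=> i j; rewrite mul_col_form mxE eqxx form_simple.
have s_spans : spans s.
  elim/(coxeter_ind m_cox pres) => [|t w [u <-]]; first by exists [::]; apply: gen_prod_nil.
  by exists (idx t :: u); rewrite gen_prod_cons /s sSK.
have off i j : i != j -> mI i j != 1%N.
  by apply: contra => /eqP/m1 ij; rewrite -(idxK i) ij idxK.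
have rep : reflection_rep s mI G rho.
  split=> //.
  - by move=> i j; apply: (coxeter_relation pres).
  - by move=> i; apply/m1.
  - by move=> i; rewrite mxE /mI (proj2 (m1 (sS i) (sS i)) erefl) coxeter_entry1.
  - by move=> i j k /off ij mk; rewrite mxE; apply: coxeter_entry_cheb.
  - by move=> i j /off ij; rewrite mxE; apply: coxeter_entry_off.
  - by move=> i j; rewrite mxE; apply: coxeter_entry_ge.
have [|rho2 [rho2_1 rho2M rho2_gen]] := mx_rep (n + n)%N (fun i => wide (simple R i)) (wide_coroot G).
  by move=> i j; rewrite mul_row_col mul0mx addr0 mul_col_form mxE eqxx form_simple.
have alpha_prod (u : seq 'I_n) : uniq u ->
    exists g, alpha (gen_prod s u) = gen_prod s u ^ g.
  move=> uu; have := alpha_conj [seq s i | i <- u].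
  rewrite big_map map_inj_uniq // => /(_ uu); apply.
  by move=> _ /mapP[i _ ->]; apply/set_mem/valP.
have alpha_gen i : exists x, alpha (s i) = s i ^ x.
  by have [x] := alpha_prod [:: i] erefl; rewrite gen_prod_cons gen_prod_nil mulg1; exists x.
have [x xE] := choice alpha_gen.
have [beta _ betaK] := alpha_aut.
have alphaM v w : alpha (v * w) = alpha v * alpha w by apply: gmulfM.
have [F autF FE] := root_automorphism_of_conj rep rho2_1 rho2M rho2_gen alphaM betaK xE alpha_prod.
have [g gE] := global_conjugator rep autF.
exists g; elim/(word_ind rep) => [|i w IHw].
  by rewrite conj1g; apply: (mulgI (alpha 1)); rewrite -alphaM !mulg1.
rewrite alphaM IHw xE conjMg; congr (_ * _).
have [c c2 cE] := FE i; have [d d2 dE] := gE i.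
apply: (reflection_eq rep (c := (c * d)%R)); first by rewrite exprMn c2 d2 mulr1.
by rewrite -scalerA -dE cE scalerA -expr2 c2 scale1r.
Qed.
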